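(* Let $g\in(0,\infty)$ be a fixed constant and $h\in(0,\infty)$. Let $(X_{i,j})_{i,j}$ be independent and identically distributed real random variables with zero mean, unit variance, and finite fourth moment, and let $Y_i$ take values in $\{0,1\}$. For each $n$, with dimension $d_n$, let $X_i=(X_{i,1},\dots,X_{i,d_n})^T\in\mathbb{R}^{d_n}$ for $i=1,\dots,n$, $X=(X_1,\dots,X_n)^T$, and let $\pi_n$ be the Bayesian logistic regression posterior density with Zellner's g-prior, $$\pi_n(\beta)\propto\prod_{i=1}^n s(\beta^TX_i)^{Y_i}\left(1-s(\beta^TX_i)\right)^{1-Y_i}\exp\left(-\frac{1}{2g}\beta^TX^TX\beta\right),\qquad\beta\in\mathbb{R}^{d_n}.$$ Let $\beta_n^*$ denote the point which maximizes $\pi_n$, and let $A(\cdot)$ be the acceptance probability of random walk Metropolis-Hastings (RWMH) targeting $\pi_n$ with Gaussian proposal centered at the current state with covariance $hI_{d_n}$. If $n\to\infty$ in such a way that $d_n/n\to\gamma\in(0,1)$, then, with probability 1, for all sufficiently large $n$, $$A(\beta_n^* )\ \le\ \left(\frac{hn(1-\sqrt\gamma)^2}{2g}+1\right)^{-d_n/2}.$$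
   Context: $s(x)=1/(1+e^{-x})$ is the sigmoid function. The posterior density $\pi_n$ is considered when $X^TX$ is positive-definite. The data-generating mechanism for the $Y_i$ need not be the logistic model. With $q(\beta,\cdot)$ the density of $N(\beta,hI_{d_n})$, the RWMH acceptance probability is $A(\beta)=\int\left[\frac{\pi_n(\beta')}{\pi_n(\beta)}\wedge1\right]q(\beta,\beta')\,d\beta'$. *)

(* Defs.v *)
From HB Require Import structures.
From mathcomp Require Import all_boot all_order all_algebra finmap.
From mathcomp Require Import all_classical all_reals all_analysis ring.

Set Implicit Arguments.
Unset Strict Implicit.
Unset Printing Implicit Defensive.

Import Order.TTheory GRing.Theory Num.Theory.
Import numFieldNormedType.Exports.

Local Open Scope classical_set_scope.
Local Open Scope ring_scope.

Section lebesgue_measure_tuple.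
Context (R : realType).

Section cons_measure.
Context (n : nat) (m : {sigma_finite_measure set (n.-tuple R) -> \bar R}).

Definition cons_pair (x : R * n.-tuple R) : n.+1.-tuple R :=
  [tuple of x.1 :: x.2].

Definition uncons_pair (t : n.+1.-tuple R) : R * n.-tuple R :=
  (thead t, [tuple of behead t]).

Lemma cons_pairK : cancel cons_pair uncons_pair.
Proof. by case=> x t; congr pair; apply: val_inj. Qed.

Lemma uncons_pairK : cancel uncons_pair cons_pair.
Proof. by move=> t; rewrite [RHS]tuple_eta; apply: val_inj. Qed.

Lemma measurable_cons_pair : measurable_fun [set: R * n.-tuple R] cons_pair.
Proof. by apply: measurable_cons. Qed.

Lemma measurable_uncons_pair : measurable_fun [set: n.+1.-tuple R] uncons_pair.
Proof.
apply: measurable_fun_pair; last exact: measurable_behead.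
exact: (measurable_tnth ord0).
Qed.

Definition cons_measure : set (n.+1.-tuple R) -> \bar R :=
  pushforward (lebesgue_measure \x m)%E cons_pair.

Let cons_measure_measure : {measure set (n.+1.-tuple R) -> \bar R} :=
  measure_function_pushforward__canonical__measure_function_Measure
    (lebesgue_measure \x m)%E measurable_cons_pair.

Let cons_measure0 : cons_measure set0 = 0%E.
Proof. exact: (measure0 cons_measure_measure). Qed.

Let cons_measure_ge0 A : (0 <= cons_measure A)%E.
Proof. exact: (measure_ge0 cons_measure_measure). Qed.

Let cons_measure_sigma_additive : semi_sigma_additive cons_measure.
Proof. exact: (@measure_semi_sigma_additive _ _ _ cons_measure_measure). Qed.

HB.instance Definition _ := isMeasure.Build _ _ _ cons_measure
  cons_measure0 cons_measure_ge0 cons_measure_sigma_additive.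

Let cons_measure_sigma_finite : sigma_finite [set: n.+1.-tuple R] cons_measure.
Proof.
have /sigma_finiteP[F [TF ndF Foo]] := sigma_finiteT (@lebesgue_measure R).
have /sigma_finiteP[G [TG ndG Goo]] := sigma_finiteT m.
exists (fun k => uncons_pair @^-1` (F k `*` G k)).
  rewrite -preimage_bigcup (_ : \bigcup_i _ = setT) ?preimage_setT//.
  apply/seteqP; split => // -[x y] _.
  have [i _ Fix] : (\bigcup_i F i) x by rewrite -TF.
  have [j _ Gjy] : (\bigcup_i G i) y by rewrite -TG.
  exists (maxn i j) => //; split.
    by move: x Fix; exact/subsetPset/ndF/leq_maxl.
  by move: y Gjy; exact/subsetPset/ndG/leq_maxr.
move=> k; have [mF Fk] := Foo k; have [mG Gk] := Goo k; split.
  rewrite -[X in measurable X]setTI; apply: measurable_uncons_pair => //.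
  exact: measurableX.
rewrite /cons_measure /pushforward -comp_preimage.
rewrite (_ : _ \o _ = id); last first.
  by rewrite funeqE => x /=; rewrite cons_pairK.
by rewrite preimage_id product_measure1E// lte_mul_pinfty// ge0_fin_numE.
Qed.

HB.instance Definition _ := Measure_isSigmaFinite.Build _ _ _ cons_measure
  cons_measure_sigma_finite.

End cons_measure.

Fixpoint lebesgue_tuple (n : nat) :
    {sigma_finite_measure set (n.-tuple R) -> \bar R} :=
  match n with
  | 0 => \d_ [tuple]
  | k.+1 => cons_measure (lebesgue_tuple k)
  end.

Lemma lebesgue_tuple_box (n : nat) (B : 'I_n -> set R) :
  (forall i, measurable (B i)) ->
  (lebesgue_tuple n [set t | forall i, B i (tnth t i)] =
   \prod_(i < n) lebesgue_measure (B i))%E.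
Proof.
elim: n B => [B _|n IH B mB] /=.
  by rewrite big_ord0 diracE mem_set//=; case.
have mBS : measurable [set t : n.-tuple R | forall i, B (lift ord0 i) (tnth t i)].
  have -> : [set t : n.-tuple R | forall i, B (lift ord0 i) (tnth t i)] =
    \bigcap_(i in [set: 'I_n]) ((@tnth n R ^~ i) @^-1` B (lift ord0 i)).
    by apply/seteqP; split => t /= H i; [move=> _|]; exact: H.
  apply: fin_bigcap_measurable => // i _.
  by rewrite -[X in measurable X]setTI; apply: measurable_tnth.
rewrite big_ord_recl -(IH (fun i => B (lift ord0 i)))// -product_measure1E//.
rewrite /cons_measure /pushforward; congr (product_measure1 _ _ _).
apply/seteqP; split => -[x t] /=.
  move=> H; split; first exact: (H ord0).
  by move=> i; have := H (lift ord0 i); rewrite tnthS.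
move=> [Hx Ht] i; case: (unliftP ord0 i) => [j ->|->//].
  by rewrite tnthS.
exact: (mB ord0).
Qed.

End lebesgue_measure_tuple.

Section random_variables.
Context (R : realType) (dsp : measure_display) (Omega : measurableType dsp).
Context (P : probability Omega R).

Definition mutually_independent (I : choiceType) (X : I -> {RV P >-> R}) : Prop :=
  forall (J : {fset I}) (B : I -> set R), (forall i, measurable (B i)) ->
  P (\bigcap_(i in [set` J]) X i @^-1` B i) =
  (\prod_(i <- J) P (X i @^-1` B i))%E.

Definition identically_distributed (I : Type) (X : I -> {RV P >-> R}) : Prop :=
  forall (i j : I) (B : set R), measurable B ->
  distribution P (X i) B = distribution P (X j) B.

End random_variables.

Section bayesian_logistic_regression.
Context (R : realType).

Definition sigmoid (x : R) : R := 1 / (1 + expR (- x)).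

Definition col_of_tuple (d : nat) (b : d.-tuple R) : 'cV[R]_d :=
  \col_(j < d) tnth b j.

Definition positive_definite (d : nat) (M : 'M[R]_d) : Prop :=
  M^T = M /\ forall v : 'cV[R]_d, v != 0 -> 0 < (v^T *m M *m v) 0 0.

Definition unnormalized_posterior (g : R) (n d : nat) (X : 'M[R]_(n, d))
    (Y : 'I_n -> bool) (b : d.-tuple R) : R :=
  (\prod_(i < n)
     (sigmoid (((col_of_tuple b)^T *m (row i X)^T) 0 0) ^+ Y i *
      (1 - sigmoid (((col_of_tuple b)^T *m (row i X)^T) 0 0)) ^+ (1 - Y i)%N)) *
  expR (- (1 / (2 * g) *
           ((col_of_tuple b)^T *m X^T *m X *m col_of_tuple b) 0 0)).

(* If [X^T *m X] is positive definite then the integral below is finite and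
   positive, so that this is a probability density. *)
Definition posterior (g : R) (n d : nat) (X : 'M[R]_(n, d))
    (Y : 'I_n -> bool) (b : d.-tuple R) : R :=
  unnormalized_posterior g X Y b /
  \int[lebesgue_tuple R d]_b' unnormalized_posterior g X Y b'.

Definition maximizes (T : Type) (f : T -> R) (x : T) : Prop :=
  forall y, f y <= f x.

Definition gaussian_pdf (d : nat) (m : d.-tuple R) (h : R) (x : d.-tuple R) : R :=
  (2 * pi * h) `^ (- (d%:R / 2)) *
  expR (- ((\sum_(j < d) (tnth x j - tnth m j) ^+ 2) / (2 * h))).

Lemma gaussian_pdf_prod (d : nat) (m : d.-tuple R) (h : R) (x : d.-tuple R) :
  0 < h ->
  gaussian_pdf m h x =
  \prod_(j < d) normal_pdf (tnth m j) (Num.sqrt h) (tnth x j).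
Proof.
move=> h0; have sh0 : Num.sqrt h != 0 by rewrite gt_eqF// sqrtr_gt0.
under eq_bigr do rewrite normal_pdfE//.
rewrite big_split/= /gaussian_pdf; congr (_ * _).
  rewrite prodr_const card_ord /normal_peak sqr_sqrtr ?(ltW h0)//.
  rewrite powRN exprVn; congr (_^-1).
  have -> : h * pi *+ 2 = 2 * pi * h by rewrite -mulr_natl; ring.
  rewrite -powR12_sqrt ?mulr_ge0 ?pi_ge0 ?(ltW h0)//.
  rewrite -powR_mulrn ?powR_ge0// -powRrM; congr (_ `^ _); ring.
rewrite -expR_sum mulr_suml -sumrN; congr expR; apply: eq_bigr => j _.
by rewrite sqr_sqrtr ?(ltW h0)// mulNr mulr_natl.
Qed.

Definition rwmh_acceptance (d : nat) (h : R) (p : d.-tuple R -> R)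
    (b : d.-tuple R) : \bar R :=
  (\int[lebesgue_tuple R d]_b'
     (Num.min (p b' / p b) 1 * gaussian_pdf b h b')%:E)%E.

End bayesian_logistic_regression.

(* Main.v *)
From HB Require Import structures.
Require Import Defs.
From mathcomp Require Import all_boot all_order all_algebra finmap.
From mathcomp Require Import all_classical all_reals all_analysis.
From mathcomp Require Import measurable_realfun ring lra zify.
Import Order.TTheory GRing.Theory Num.Theory.
Import numFieldNormedType.Exports.

Set Implicit Arguments.
Unset Strict Implicit.
Unset Printing Implicit Defensive.

Local Open Scope classical_set_scope.
Local Open Scope ring_scope.

(** Write X for the n x d design matrix, x_1, ..., x_d for its columns and
    c = h / g.  The logistic likelihood is log-concave and the prior is Gaussian
    with precision X^T X / g, so the log-posterior is strongly concave and at
    the mode b* one has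
      pi(b) / pi(b* ) <= exp (- |X (b - b* )|^2 / (2 g))    ([potential_gap]).
    The acceptance probability at b* is therefore at most the Gaussian integral
    of exp (- |X z|^2 / (2 g)) for z distributed as N(0, h I).  Integrating out
    one coordinate of z at a time ([gaussian_quadratic_bound]) bounds it by
      V = prod_j (1 + c q_j)^(-1/2),
    where q_j is the squared distance from x_j to the span of the columns
    that follow it; each step is a one-dimensional Gaussian integral.

    It remains to bound V from above, and here the bound claimed leaves room: it
    asks for V <= (1 + c b n / 2)^(-d/2) with b = (1 - sqrt gamma)^2, whereas
    q_j is typically at least n - d, about (1 - gamma) n, and 1 - gamma > b.
    Given the columns after x_j, q_j = |M x_j|^2 for an orthogonal projection M
    of trace at least n - d; its conditional mean is that trace and, the entries
    having four moments, its conditional variance is O(n) ([quad_variance]).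
    Hence the conditional mean of (1 + c q_j)^(-1/2) is at most
    (1 + c b n)^(-1/2) + O(1 / n), and multiplying over the columns gives
    ([expected_volume_factor]) an expectation of V that is smaller than
    (1 + c b n / 2)^(-d/2) by an exponential factor.  Markov's inequality and the
    Borel-Cantelli lemma conclude.

    The Gram matrix must also be positive definite, that is no q_j may vanish.
    The variance bound only gives this with probability 1 - O(1 / n) for each
    column, which is not summable.  Instead, a vector in the kernel of a matrix
    of rank r is determined by n - r of its coordinates, so a random vector
    with independent entries hits this kernel with probability at most p^r,
    where p < 1 bounds the atoms of the entries ([kernel_hit_bound], an argument
    of Odlyzko).  Here r >= n - d, which makes the failure exponentially rare. *)

(** * Successive orthogonal projections *)

Section deflation.
Context (R : realFieldType) (n : nat).
Implicit Types (M : 'M[R]_n) (x v : 'cV[R]_n) (s : seq 'cV[R]_n).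

Definition sqnorm v : R := (v^T *m v) 0 0.

Lemma sqnormE v : sqnorm v = \sum_i v i 0 ^+ 2.
Proof. by rewrite /sqnorm mxE; apply: eq_bigr => i _; rewrite mxE expr2. Qed.

Lemma sqnorm_ge0 v : 0 <= sqnorm v.
Proof. by rewrite sqnormE sumr_ge0// => i _; exact: sqr_ge0. Qed.

Lemma sqnorm_eq0 v : (sqnorm v == 0) = (v == 0).
Proof.
apply/eqP/eqP => [|->]; last by rewrite /sqnorm mulmx0 mxE.
rewrite sqnormE => /psumr_eq0P H; apply/colP => i; rewrite mxE.
by apply/eqP; rewrite -sqrf_eq0; apply/eqP/H => // j _; exact: sqr_ge0.
Qed.

Definition orthoproj M := M^T = M /\ M *m M = M.

(** If [M] is the orthogonal projection onto a subspace, [deflate M x] is the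
    projection onto its part orthogonal to [x].  When [M *m x = 0] the inverse
    is the inverse of zero, which is zero, and [M] is left unchanged. *)
Definition deflate M x : 'M[R]_n :=
  M - (sqnorm (M *m x))^-1 *: ((M *m x) *m (M *m x)^T).

Lemma orthoproj1 : orthoproj 1%:M.
Proof. by split; rewrite ?trmx1 ?mul1mx. Qed.

Lemma orthoproj_quad M v : orthoproj M -> sqnorm (M *m v) = (v^T *m M *m v) 0 0.
Proof. by case=> Ms Mi; rewrite /sqnorm trmx_mul Ms mulmxA -[v^T *m M *m M]mulmxA Mi. Qed.

Lemma deflate0 M x : M *m x = 0 -> deflate M x = M.
Proof. by move=> Mx0; rewrite /deflate Mx0 mul0mx scaler0 subr0. Qed.

Lemma orthoproj_deflate M x : orthoproj M -> orthoproj (deflate M x).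
Proof.
move=> pM; have [Ms Mi] := pM.
have [/deflate0 ->//|y0] := eqVneq (M *m x) 0.
rewrite /deflate; set y := M *m x in y0 *; set q := sqnorm y.
have q0 : q != 0 by rewrite sqnorm_eq0.
have My : M *m y = y by rewrite /y mulmxA Mi.
have yM : y^T *m M = y^T by rewrite -{1}Ms -trmx_mul My.
split; first by rewrite linearB linearZ/= trmx_mul trmxK Ms.
set Q := y *m y^T.
have MQ : M *m Q = Q by rewrite /Q mulmxA My.
have QM : Q *m M = Q by rewrite /Q -mulmxA yM.
have QQ : Q *m Q = q *: Q.
  by rewrite /Q -mulmxA (mulmxA y^T) [y^T *m y]mx11_scalar mul_scalar_mx scalemxAr.
rewrite mulmxBl !mulmxBr -!scalemxAl -!scalemxAr Mi MQ QM QQ !scalerA.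
by rewrite -mulrA mulVf// mulr1 subrr subr0.
Qed.

Lemma mxtrace_outer (y : 'cV[R]_n) : \tr (y *m y^T) = sqnorm y.
Proof. by rewrite mxtrace_mulC /mxtrace big_ord1. Qed.

Lemma mxtrace_deflate M x : \tr M - 1 <= \tr (deflate M x) <= \tr M.
Proof.
rewrite /deflate linearB linearZ/= mxtrace_outer.
have [->|q0] := eqVneq (sqnorm (M *m x)) 0.
  by rewrite mulr0 subr0 lexx gerBl ler01.
by rewrite mulVf// lexx gerBl ler01.
Qed.

(** Both the trace and the rank drop by at most one at each step.  For a projection
    they agree, but it is simpler to follow them separately: the trace controls
    the mean of a residual, the rank the probability that it vanishes. *)
Lemma mxrank_deflate M x : (\rank M <= (\rank (deflate M x)).+1)%N.
Proof.
rewrite -{1}(subrK (deflate M x) M) addrC -addn1.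
apply: leq_trans (mxrank_add _ _) _; rewrite leq_add2l /deflate opprB addrC subrK.
apply: leq_trans (mxrank_scale _ _) _; apply: leq_trans (mxrankM_maxl _ _) _.
exact: rank_leq_col.
Qed.

Lemma orthoproj_frobenius M : orthoproj M -> \sum_i \sum_l M i l ^+ 2 = \tr M.
Proof.
move=> [Ms Mi]; rewrite -[in RHS]Mi; apply: eq_bigr => i _; rewrite mxE.
by apply: eq_bigr => l _; rewrite -[in X in _ * X]Ms mxE expr2.
Qed.

Lemma deflate_ker M x v : M *m v = 0 -> orthoproj M -> deflate M x *m v = 0.
Proof.
move=> Mv [Ms _]; have E : (M *m x)^T *m v = 0.
  by rewrite trmx_mul Ms -mulmxA Mv mulmx0.
by rewrite /deflate mulmxBl Mv -scalemxAl -(mulmxA (M *m x)) E mulmx0 scaler0 subr0.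
Qed.

Lemma deflate_self M x : orthoproj M -> deflate M x *m x = 0.
Proof.
move=> pM; have [Ms Mi] := pM.
have [Mx0|y0] := eqVneq (M *m x) 0; first by rewrite deflate0.
rewrite /deflate mulmxBl -scalemxAl -(mulmxA (M *m x)).
rewrite (_ : (M *m x)^T *m x = (sqnorm (M *m x))%:M).
  by rewrite mul_mx_scalar scalerA mulVf ?sqnorm_eq0// scale1r subrr.
by rewrite [LHS]mx11_scalar orthoproj_quad// trmx_mul Ms.
Qed.

(** Pythagoras: the part of [M *m v] along [M *m x] is removed. *)
Lemma sqnorm_deflate M x v : orthoproj M ->
  sqnorm (deflate M x *m v) =
  sqnorm (M *m v) - ((x^T *m M *m v) 0 0) ^+ 2 / sqnorm (M *m x).
Proof.
move=> pM; have [Ms Mi] := pM.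
rewrite !(orthoproj_quad _ (orthoproj_deflate _ pM)) (orthoproj_quad v pM).
set t := (x^T *m M *m v) 0 0.
have yv : (M *m x)^T *m v = t%:M by rewrite [LHS]mx11_scalar trmx_mul Ms.
have vy : v^T *m (M *m x) = t%:M.
  by rewrite -[M *m x]trmxK -trmx_mul yv tr_scalar_mx.
rewrite /deflate mulmxBr mulmxBl -scalemxAr -scalemxAl.
rewrite mulmxA vy -(mulmxA t%:M) yv -scalar_mxM scale_scalar_mx.
by rewrite mxE [X in _ + X]mxE [X in _ - X]mxE eqxx mulr1n -expr2 [_^-1 * _]mulrC.
Qed.

(** The projection onto the orthogonal of the span of [s].  It is built one
    vector at a time, as the Gaussian integral and the conditional expectations
    below are computed one column at a time. *)
Definition residual_proj s : 'M[R]_n := foldr (fun x M => deflate M x) 1%:M s.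

Definition residual s x : R := sqnorm (residual_proj s *m x).

Lemma residual_ge0 s x : 0 <= residual s x. Proof. exact: sqnorm_ge0. Qed.

Lemma orthoproj_residual s : orthoproj (residual_proj s).
Proof. by elim: s => [|x s IH]; [exact: orthoproj1|exact: orthoproj_deflate]. Qed.

Lemma mxtrace_residual s :
  n%:R - (size s)%:R <= \tr (residual_proj s) <= n%:R.
Proof.
elim: s => [|x s /andP[IH1 IH2]] /=; first by rewrite mxtrace1 subr0 lexx.
have /andP[d1 d2] := mxtrace_deflate (residual_proj s) x.
by rewrite (le_trans d2 IH2) andbT -natr1; move: IH1 d1 d2; lra.
Qed.

Lemma mxrank_residual s : (n <= \rank (residual_proj s) + size s)%N.
Proof.
elim: s => [|x s IH] /=; first by rewrite mxrank1 addn0.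
apply: leq_trans IH _; rewrite addnS -addSn leq_add2r.
exact: mxrank_deflate.
Qed.

Lemma residual_proj_mem s x : x \in s -> residual_proj s *m x = 0.
Proof.
elim: s => // y s IH; rewrite inE => /predU1P[->|/IH xs] /=.
  by apply: deflate_self; exact: orthoproj_residual.
by apply: deflate_ker => //; exact: orthoproj_residual.
Qed.

Fixpoint regular s : bool :=
  if s is x :: s' then (residual s' x != 0) && regular s' else true.

(** Apply to a vanishing combination the projection that kills all the vectors but
    the first one: its coefficient must vanish, and one proceeds by induction. *)
Lemma regular_free (J : eqType) (c : J -> 'cV[R]_n) (z : J -> R) (js : seq J) :
  regular [seq c j | j <- js] -> \sum_(j <- js) z j *: c j = 0 ->
  forall j, j \in js -> z j = 0.
Proof.
elim: js => // j js IH /= /andP[res reg]; rewrite big_cons => sum0.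
have zj : z j = 0.
  move/(congr1 (mulmx (residual_proj [seq c j | j <- js]))): sum0.
  rewrite mulmx0 mulmxDr mulmx_sumr big_seq big1 => [|i ijs]; last first.
    by rewrite -scalemxAr residual_proj_mem ?scaler0// map_f.
  rewrite addr0 -scalemxAr => /eqP; rewrite scaler_eq0 -sqnorm_eq0.
  by rewrite -/(residual _ _) (negbTE res) orbF => /eqP.
move: sum0; rewrite zj scale0r add0r => sum0 i; rewrite inE.
by move=> /predU1P[->//|]; exact: IH.
Qed.

End deflation.

(** * A Gaussian integral *)

(** The sum of two Gaussian exponents, of inverse variances [a] and [h^-1], is one
    of inverse variance [D / h] up to a constant. *)
Lemma complete_square (R : realFieldType) (h a y e D : R) : h != 0 -> D != 0 ->
  D = 1 + h * a ->
  a / 2 * (y + e) ^+ 2 + y ^+ 2 / (h *+ 2) =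
  (y + h * a * e / D) ^+ 2 / (h / D *+ 2) + a * e ^+ 2 / (2 * D).
Proof.
move=> h0 D0 DE; rewrite -(mulr_natl h 2) -(mulr_natl (h / D) 2).
have -> : e = e / D * D by rewrite divfK.
set u := e / D.
rewrite [RHS](_ : _ = ((y + h * a * u) ^+ 2 * D * h^-1 + a * u ^+ 2 * D) / 2); last first.
  by clearbody u; clear DE; field; rewrite h0 D0.
rewrite [LHS](_ : _ = (a * (y + u * D) ^+ 2 + y ^+ 2 * h^-1) / 2); last first.
  by clearbody u; clear DE D0; field; rewrite ?h0.
congr (_ / 2); rewrite DE; clearbody u; clear DE D0.
by field; rewrite ?h0.
Qed.

Section gaussian_integral.
Context (R : realType) (h : R).
Hypothesis h0 : 0 < h.

(** Completing the square leaves a normal density of variance [h / (1 + h * a)];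
    the exponential factor in [e] that comes out is at most one and is dropped. *)
Lemma gaussian_square_bound (a m e : R) : 0 <= a ->
  (\int[@lebesgue_measure R]_z
     (expR (- (a / 2 * (z - m + e) ^+ 2)) * normal_pdf m (Num.sqrt h) z)%:E <=
   ((Num.sqrt (1 + h * a))^-1)%:E)%E.
Proof.
move=> a0; set D := 1 + h * a.
have ha0 : 0 <= h * a by rewrite mulr_ge0// ltW.
have D0 : 0 < D by rewrite /D; lra.
pose s := Num.sqrt (h / D); pose m' := m - h * a * e / D.
have hD0 : 0 < h / D by rewrite divr_gt0.
have s0 : s != 0 by rewrite gt_eqF// sqrtr_gt0.
have sh0 : Num.sqrt h != 0 by rewrite gt_eqF// sqrtr_gt0.
apply: (@le_trans _ _ (\int[@lebesgue_measure R]_z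
   ((Num.sqrt D)^-1%:E * (normal_pdf m' s z)%:E))%E); last first.
  rewrite ge0_integralZl_EFin//.
  - by rewrite integral_normal_pdf// mule1.
  - by move=> x _; rewrite lee_fin normal_pdf_ge0.
  - by apply/measurable_EFinP; exact: measurable_normal_pdf.
apply: ge0_le_integral => //.
- by move=> x _; rewrite lee_fin mulr_ge0 ?expR_ge0 ?normal_pdf_ge0.
- apply/measurable_EFinP; apply: measurable_funM; last exact: measurable_normal_pdf.
  apply: measurableT_comp => //; apply: measurableT_comp => //.
  apply: measurable_funM => //; apply: measurable_funX.
  by apply: measurable_funD => //; exact: measurable_funB.
- apply/measurable_EFinP; apply: measurable_funM => //; exact: measurable_normal_pdf.
move=> z _; rewrite -EFinM lee_fin !normal_pdfE//.
have -> : (Num.sqrt D)^-1 * (normal_peak s * normal_fun m' s z) =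
    normal_peak (Num.sqrt h) * normal_fun m' s z.
  rewrite mulrA; congr (_ * _); rewrite /normal_peak !sqr_sqrtr ?ltW//.
  rewrite -invfM -sqrtrM ?ltW//; congr (Num.sqrt _)^-1.
  by rewrite -mulrnAr mulrA mulrCA mulfV ?gt_eqF// mulr1 mulrnAr.
rewrite mulrCA ler_wpM2l ?normal_peak_ge0// /normal_fun -expRD ler_expR.
rewrite !sqr_sqrtr ?(ltW h0) ?(ltW hD0)// /m'.
rewrite -subr_ge0.
have -> : - (z - (m - h * a * e / D)) ^+ 2 / (h / D *+ 2) -
    (- (a / 2 * (z - m + e) ^+ 2) + - (z - m) ^+ 2 / (h *+ 2)) =
    a * e ^+ 2 / (2 * D).
  have Dn0 : D != 0 by rewrite gt_eqF.
  have hn0 : h != 0 by rewrite gt_eqF.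
  have := complete_square (z - m) e hn0 Dn0 erefl.
  have -> : z - (m - h * a * e / D) = z - m + h * a * e / D by ring.
  by rewrite !mulNr; lra.
by apply: divr_ge0; apply: mulr_ge0 => //; [exact: sqr_ge0|exact: ltW].
Qed.

Context (n : nat).
Implicit Types (s : seq 'cV[R]_n).

(** For [s] the columns of a matrix [X], this is an upper bound of the inverse
    square root of the determinant of [1 + h a X^T X]. *)
Fixpoint volume_factor (a : R) s : R :=
  if s is x :: s' then
    (Num.sqrt (1 + h * (a * residual s' x)))^-1 * volume_factor a s'
  else 1.

Lemma volume_factor_ge0 a s : 0 <= volume_factor a s.
Proof. by elim: s => //= x s IH; rewrite mulr_ge0// invr_ge0 sqrtr_ge0. Qed.

Definition displacement s (d : nat) (m z : d.-tuple R) : 'cV[R]_n :=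
  \sum_(i < d) (tnth z i - tnth m i) *: nth 0 s i.

Lemma sqnormD (u w : 'cV[R]_n) t :
  sqnorm (u + t *: w) = sqnorm u + 2 * t * (w^T *m u) 0 0 + t ^+ 2 * sqnorm w.
Proof.
rewrite !sqnormE mxE !mulr_sumr -!big_split/=; apply: eq_bigr => i _.
by rewrite !mxE; ring.
Qed.

Lemma measurable_sqnorm_displacement s d (m : d.-tuple R) v :
  measurable_fun [set: d.-tuple R] (fun z => sqnorm (v + displacement s m z)).
Proof.
under eq_fun do rewrite sqnormE.
apply: measurable_sum => i; apply: measurable_funX.
rewrite (_ : (fun _ => _) =
    fun z => v i 0 + \sum_(j < d) (tnth z j - tnth m j) * (nth 0 s j) i 0).
  apply: measurable_funD => //; apply: measurable_sum => j.
  apply: measurable_funM => //; apply: measurable_funB => //.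
  exact: measurable_tnth.
apply/funext => z; rewrite mxE summxE; congr (_ + _).
by apply: eq_bigr => j _; rewrite mxE.
Qed.

Lemma measurable_gaussian_pdf d (m : d.-tuple R) :
  measurable_fun [set: d.-tuple R] (gaussian_pdf m h).
Proof.
apply: measurable_funM => //; apply: measurableT_comp => //.
apply: measurableT_comp => //; apply: measurable_funM => //.
apply: measurable_sum => j; apply: measurable_funX.
by apply: measurable_funB => //; exact: measurable_tnth.
Qed.

Lemma gaussian_pdf_ge0 d (m z : d.-tuple R) : 0 <= gaussian_pdf m h z.
Proof. by rewrite /gaussian_pdf mulr_ge0 ?powR_ge0 ?expR_ge0. Qed.

Lemma gaussian_pdf_cons d (m z : d.-tuple R) m0 z0 :
  gaussian_pdf [tuple of m0 :: m] h [tuple of z0 :: z] =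
  normal_pdf m0 (Num.sqrt h) z0 * gaussian_pdf m h z.
Proof.
rewrite !gaussian_pdf_prod// big_ord_recl !(tnth_nth 0)/=; congr (_ * _).
by apply: eq_bigr => i _; rewrite !(tnth_nth 0).
Qed.

Lemma integral_lebesgue_tuple_cons d (f : d.+1.-tuple R -> \bar R) :
  measurable_fun [set: d.+1.-tuple R] f -> (forall z, 0 <= f z)%E ->
  (\int[lebesgue_tuple R d.+1]_z f z =
   \int[@lebesgue_measure R]_z0 \int[lebesgue_tuple R d]_z f [tuple of z0 :: z])%E.
Proof.
move=> mf f0.
have mc := @measurable_cons_pair R d.
transitivity (\int[(@lebesgue_measure R) \x (lebesgue_tuple R d)]_p f (cons_pair p))%E.
  rewrite -[LHS]/(\int[pushforward (@lebesgue_measure R \x lebesgue_tuple R d)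
    (@cons_pair R d)]_z f z)%E.
  by rewrite ge0_integral_pushforward// preimage_setT.
have mfc := measurableT_comp mf mc.
exact: (@fubini_tonelli1 _ _ _ _ R (@lebesgue_measure R) (lebesgue_tuple R d)
  (f \o @cons_pair R d) mfc (fun p => f0 (cons_pair p))).
Qed.

(** The inner integral is over the coordinates that follow the first one.  By
    induction it leaves the squared norm of the projection orthogonal to the
    columns [s], which is a quadratic polynomial in the first coordinate with
    leading coefficient [residual s x].  The shift [v] is what makes the
    induction go through. *)
Lemma gaussian_quadratic_bound (a : R) d s (m : d.-tuple R) v : 0 <= a ->
  size s = d ->
  (\int[lebesgue_tuple R d]_z
     (expR (- (a / 2 * sqnorm (v + displacement s m z))) * gaussian_pdf m h z)%:E <=
   (volume_factor a s * expR (- (a / 2 * sqnorm (residual_proj s *m v))))%:E)%E.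
Proof.
move=> a0.
have mF d' s' (m' : d'.-tuple R) v' : measurable_fun [set: d'.-tuple R]
    (fun z => (expR (- (a / 2 * sqnorm (v' + displacement s' m' z))) *
       gaussian_pdf m' h z)%:E).
  apply/measurable_EFinP; apply: measurable_funM; last exact: measurable_gaussian_pdf.
  apply: measurableT_comp => //; apply: measurableT_comp => //.
  by apply: measurable_funM => //; exact: measurable_sqnorm_displacement.
have F0 d' s' (m' : d'.-tuple R) v' z :
    (0 <= (expR (- (a / 2 * sqnorm (v' + displacement s' m' z))) *
       gaussian_pdf m' h z)%:E)%E.
  by rewrite lee_fin mulr_ge0 ?expR_ge0 ?gaussian_pdf_ge0.
elim: d s m v => [|d IH] [|x s] m v //.
  move=> _; rewrite /= integral_dirac//; last exact: mF.
  rewrite diracT mul1e lee_fin /displacement big_ord0 addr0 mul1mx mul1r.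
  by rewrite gaussian_pdf_prod// big_ord0 mulr1.
move=> [sd]; rewrite [m]tuple_eta; set m0 := thead m; set mt := [tuple of behead m].
rewrite integral_lebesgue_tuple_cons//.
have dispS (z : d.-tuple R) z0 :
    displacement (x :: s) [tuple of m0 :: mt] [tuple of z0 :: z] =
    (z0 - m0) *: x + displacement s mt z.
  rewrite /displacement big_ord_recl !(tnth_nth 0)/=; congr (_ + _).
  by apply: eq_bigr => i _; rewrite !(tnth_nth 0).
set P := residual_proj s.
have pP : orthoproj P := orthoproj_residual s.
pose G z0 := expR (- (a / 2 * sqnorm (P *m (v + (z0 - m0) *: x)))) *
  normal_pdf m0 (Num.sqrt h) z0.
have mG : measurable_fun [set: R] (EFin \o G).
  apply/measurable_EFinP; apply: measurable_funM; last exact: measurable_normal_pdf.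
  apply: measurableT_comp => //; apply: measurableT_comp => //.
  apply: measurable_funM => //.
  rewrite (_ : (fun _ => _) = fun z0 => sqnorm (P *m v) +
     2 * (z0 - m0) * ((P *m x)^T *m (P *m v)) 0 0 + (z0 - m0) ^+ 2 * sqnorm (P *m x)).
    have mz : measurable_fun [set: R] (fun z0 : R => z0 - m0) by exact: measurable_funB.
    apply: measurable_funD; last by apply: measurable_funM => //; exact: measurable_funX.
    apply: measurable_funD => //; apply: measurable_funM => //.
    exact: measurable_funM.
  by apply/funext => z0; rewrite mulmxDr -scalemxAr sqnormD.
have G0 z0 : 0 <= G z0 by rewrite mulr_ge0 ?expR_ge0 ?normal_pdf_ge0.
(* G is what remains as a function of the first coordinate, up to a constant. *)
apply: (@le_trans _ _ (\int[@lebesgue_measure R]_z0 ((volume_factor a s)%:E * (G z0)%:E))%E).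
  apply: ge0_le_integral => //.
  - by move=> z0 _; apply: integral_ge0 => z _; exact: F0.
  - pose Fc (p : R * d.-tuple R) := (expR (- (a / 2 * sqnorm (v +
        displacement (x :: s) [tuple of m0 :: mt] (cons_pair p)))) *
        gaussian_pdf [tuple of m0 :: mt] h (cons_pair p))%:E.
    have mFc : measurable_fun [set: R * d.-tuple R] Fc.
      exact: (measurableT_comp (mF _ (x :: s) [tuple of m0 :: mt] v)
        (@measurable_cons_pair R d)).
    exact: (measurable_fun_fubini_tonelli_F Fc mFc (fun p => F0 _ _ _ _ _)).
  - by apply: measurable_funeM.
  move=> z0 _.
    apply: (@le_trans _ _ ((normal_pdf m0 (Num.sqrt h) z0)%:E *
     \int[lebesgue_tuple R d]_z (expR (- (a / 2 * sqnorm (v + (z0 - m0) *: x +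
        displacement s mt z))) * gaussian_pdf mt h z)%:E)%E).
    rewrite -ge0_integralZl_EFin; [|by []|by move=> *; exact: F0|exact: mF|
      exact: normal_pdf_ge0].
    rewrite le_eqVlt; apply/orP; left; apply/eqP; apply: eq_integral => z _.
    by rewrite dispS gaussian_pdf_cons addrA -EFinM mulrCA.
    apply: (@le_trans _ _ ((normal_pdf m0 (Num.sqrt h) z0)%:E *
     (volume_factor a s * expR (- (a / 2 * sqnorm (P *m (v + (z0 - m0) *: x)))))%:E)%E).
    by apply: lee_wpmul2l; [rewrite lee_fin normal_pdf_ge0|exact: IH].
  by rewrite -!EFinM lee_fin /G mulrC mulrA.
rewrite ge0_integralZl_EFin ?volume_factor_ge0//; last by move=> z0 _; rewrite lee_fin.
rewrite /= -[(_^-1 * _ * _)%R]mulrA mulrCA EFinM.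
apply: lee_wpmul2l; first by rewrite lee_fin volume_factor_ge0.
set q := residual s x; set b := (x^T *m P *m v) 0 0.
pose E0 := expR (- (a / 2 * sqnorm (deflate P x *m v))).
have q0 : 0 <= q := residual_ge0 s x.
have GE z0 : G z0 = E0 * (expR (- ((a * q) / 2 * (z0 - m0 + b / q) ^+ 2)) *
     normal_pdf m0 (Num.sqrt h) z0).
  rewrite /G /E0 mulrA -expRD; congr (expR _ * _).
  rewrite sqnorm_deflate// mulmxDr -scalemxAr sqnormD -/b -/(residual s x) -/q.
  have -> : ((P *m x)^T *m (P *m v)) 0 0 = b.
    by case: pP => Ps Pi; rewrite /b trmx_mul Ps mulmxA -[x^T *m P *m P]mulmxA Pi.
  have [q_eq0|qn0] := eqVneq q 0; last by field.
  have b0 : b = 0.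
    have /eqP Px0 : P *m x == 0 by rewrite -sqnorm_eq0; apply/eqP.
    by case: pP => Ps Pi; rewrite /b -[in x^T *m P]Ps -trmx_mul Px0 trmx0 mul0mx mxE.
  by rewrite q_eq0 b0; ring.
under eq_integral do rewrite GE EFinM.
rewrite ge0_integralZl_EFin ?expR_ge0//; first last.
- apply/measurable_EFinP; apply: measurable_funM; last exact: measurable_normal_pdf.
  apply: measurableT_comp => //; apply: measurableT_comp => //.
  apply: measurable_funM => //; apply: measurable_funX.
  by apply: measurable_funD => //; exact: measurable_funB.
- by move=> z0 _; rewrite lee_fin mulr_ge0 ?expR_ge0 ?normal_pdf_ge0.
rewrite [X in (_ <= X%:E)%E]mulrC [leRHS]EFinM.
apply: lee_wpmul2l; first by rewrite lee_fin expR_ge0.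
by apply: gaussian_square_bound; rewrite mulr_ge0.
Qed.

End gaussian_integral.

(** * Measurability of matrix-valued maps *)

Section measurable_matrices.
Context (R : realType) (d : measure_display) (T : measurableType d).

Definition measurable_mx (m n : nat) (f : T -> 'M[R]_(m, n)) :=
  forall i j, measurable_fun [set: T] (fun t => f t i j).

Lemma measurable_mx_cst m n (A : 'M[R]_(m, n)) : measurable_mx (fun=> A).
Proof. by move=> i j. Qed.

Lemma measurable_mx_tr m n (f : T -> 'M[R]_(m, n)) :
  measurable_mx f -> measurable_mx (fun t => (f t)^T).
Proof. by move=> mf i j; under eq_fun do rewrite mxE; exact: mf. Qed.

Lemma measurable_mxM m n p (f : T -> 'M[R]_(m, n)) (g : T -> 'M[R]_(n, p)) :
  measurable_mx f -> measurable_mx g -> measurable_mx (fun t => f t *m g t).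
Proof.
move=> mf mg i j; under eq_fun do rewrite mxE.
by apply: measurable_sum => l; apply: measurable_funM.
Qed.

Lemma measurable_mxB m n (f g : T -> 'M[R]_(m, n)) :
  measurable_mx f -> measurable_mx g -> measurable_mx (fun t => f t - g t).
Proof.
move=> mf mg i j; rewrite (_ : (fun _ => _) = fun t => f t i j - g t i j).
  exact: measurable_funB.
by apply/funext => t; rewrite !mxE.
Qed.

Lemma measurable_mxZ m n (c : T -> R) (f : T -> 'M[R]_(m, n)) :
  measurable_fun [set: T] c -> measurable_mx f ->
  measurable_mx (fun t => c t *: f t).
Proof.
by move=> mc mf i j; under eq_fun do rewrite mxE; exact: measurable_funM.
Qed.

(** On nonnegative numbers the inverse is a power; squaring reduces to these. *)
Lemma measurable_inv (f : T -> R) : measurable_fun [set: T] f ->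
  measurable_fun [set: T] (fun t => (f t)^-1).
Proof.
move=> mf; have -> : (fun t => (f t)^-1) = (fun t => f t * (f t ^+ 2) `^ (- 1)).
  apply/funext => t; rewrite powR_inv1 ?sqr_ge0//.
  have [->|ft] := eqVneq (f t) 0; first by rewrite invr0 mul0r.
  by rewrite expr2 invfM mulrA mulfV// mul1r.
apply: measurable_funM => //.
by apply: (measurableT_comp (measurable_powR (-1))); exact: measurable_funX.
Qed.

Lemma measurable_sqnorm n (f : T -> 'cV[R]_n) :
  measurable_mx f -> measurable_fun [set: T] (fun t => sqnorm (f t)).
Proof. by move=> mf; exact: (measurable_mxM (measurable_mx_tr mf) mf). Qed.

Lemma measurable_residual_proj n (J : Type) (c : J -> T -> 'cV[R]_n) js :
  (forall j, measurable_mx (c j)) ->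
  measurable_mx (fun t => residual_proj [seq c j t | j <- js]).
Proof.
move=> mc; elim: js => [|j js IH] /=; first exact: measurable_mx_cst.
have my := measurable_mxM IH (mc j).
apply: measurable_mxB => //; apply: measurable_mxZ.
  by apply: measurable_inv; exact: measurable_sqnorm.
exact: (measurable_mxM my (measurable_mx_tr my)).
Qed.

Lemma measurable_residual n (J : Type) (c : J -> T -> 'cV[R]_n) js (f : T -> 'cV[R]_n) :
  (forall j, measurable_mx (c j)) -> measurable_mx f ->
  measurable_fun [set: T] (fun t => residual [seq c j t | j <- js] (f t)).
Proof.
move=> mc mf; apply: measurable_sqnorm; apply: measurable_mxM => //.
exact: measurable_residual_proj.
Qed.

Lemma measurable_contraction (c : R) (f : T -> R) : measurable_fun [set: T] f ->
  measurable_fun [set: T] (fun t => (Num.sqrt (1 + c * f t))^-1).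
Proof.
move=> mf; apply: measurable_inv; apply: (measurableT_comp (continuous_measurable_fun (@sqrt_continuous R))).
by apply: measurable_funD => //; exact: measurable_funM.
Qed.

Lemma measurable_volume_factor h a n (J : Type) (c : J -> T -> 'cV[R]_n) js :
  (forall j, measurable_mx (c j)) ->
  measurable_fun [set: T] (fun t => volume_factor h a [seq c j t | j <- js]).
Proof.
move=> mc; elim: js => [|j js IH] //=.
apply: measurable_funM => //; apply: measurable_contraction.
by apply: measurable_funM => //; exact: measurable_residual.
Qed.

End measurable_matrices.

(** * Geometry of the log-posterior *)

Section softplus.
Context (R : realType).

Definition softplus (x : R) : R := ln (1 + expR x).

Lemma expR_softplus x : expR (softplus x) = 1 + expR x.
Proof. by rewrite lnK// posrE addr_gt0// expR_gt0. Qed.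

Lemma softplus_ge0 x : 0 <= softplus x.
Proof. by rewrite ln_ge0// lerDl expR_ge0. Qed.

Lemma expR_convex_combination (c x : R) : 0 <= c <= 1 ->
  expR (c * x) <= 1 - c + c * expR x.
Proof.
move=> /andP[c0 c1]; set E := expR (c * x).
have E0 : 0 <= E by exact: expR_ge0.
have e1 : E * (1 - c * x) <= 1.
  rewrite [leRHS](_ : 1 = E * expR (- (c * x))); last by rewrite -expRD subrr expR0.
  by rewrite ler_wpM2l// expR_ge1Dx.
have e2 : E * (1 + (1 - c) * x) <= expR x.
  rewrite [leRHS](_ : _ = E * expR ((1 - c) * x)); last first.
    by rewrite -expRD; congr expR; ring.
  by rewrite ler_wpM2l// expR_ge1Dx.
have {}e1 : (1 - c) * (E * (1 - c * x)) <= 1 - c.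
  by rewrite -[leRHS]mulr1 ler_wpM2l// subr_ge0.
have {}e2 : c * (E * (1 + (1 - c) * x)) <= c * expR x by rewrite ler_wpM2l.
by lra.
Qed.

(** With weight [c = expR y / (1 + expR y)], the ratio of [1 + expR x] to
    [1 + expR y] is the convex combination bounded in
    [expR_convex_combination]. *)
Lemma softplus_tangent x y :
  softplus y + expR y / (1 + expR y) * (x - y) <= softplus x.
Proof.
set c := _ / _.
have ey : 0 < expR y := expR_gt0 y.
have D0 : 0 < 1 + expR y by rewrite addr_gt0.
have c01 : 0 <= c <= 1.
  apply/andP; split; first by apply: divr_ge0; apply: ltW.
  by rewrite ler_pdivrMr// mul1r lerDr.
rewrite -ler_expR expRD !expR_softplus.
apply: le_trans (ler_wpM2l (ltW D0) (expR_convex_combination (x - y) c01)) _.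
have cD : c * (1 + expR y) = expR y by rewrite divfK ?gt_eqF.
have exy : expR x = expR y * expR (x - y) by rewrite -expRD addrC subrK.
have -> : (1 + expR y) * (1 - c + c * expR (x - y)) =
    (1 + expR y) - c * (1 + expR y) + c * (1 + expR y) * expR (x - y) by ring.
by rewrite cD -exy; lra.
Qed.

Lemma softplus_convex (t x y : R) : 0 <= t <= 1 ->
  softplus ((1 - t) * x + t * y) <= (1 - t) * softplus x + t * softplus y.
Proof.
move=> /andP[t0 t1]; set z := _ + _.
have := ler_wpM2l (_ : 0 <= 1 - t) (softplus_tangent x z).
have := ler_wpM2l t0 (softplus_tangent y z).
rewrite subr_ge0 => H1 /(_ t1) H2.
by apply: le_trans (lerD H2 H1); rewrite le_eqVlt; apply/orP; left; apply/eqP; rewrite /z; ring.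
Qed.

End softplus.

Section posterior_geometry.
Context (R : realType) (g : R) (n d : nat) (X : 'M[R]_(n, d)) (Y : 'I_n -> bool).

Let sgn (i : 'I_n) : R := if Y i then -1 else 1.

(** Minus the logarithm of the unnormalized posterior.  Both logistic
    probabilities are of the form [expR (- softplus t)], with [t] the linear
    predictor up to a sign that depends on the response. *)
Definition potential (v : 'cV[R]_d) : R :=
  \sum_i softplus (sgn i * (X *m v) i 0) + (2 * g)^-1 * sqnorm (X *m v).

Lemma unnormalized_posteriorE (b : d.-tuple R) :
  unnormalized_posterior g X Y b = expR (- potential (col_of_tuple b)).
Proof.
rewrite /unnormalized_posterior /potential opprD expRD; congr (_ * _).
  rewrite -sumrN expR_sum; apply: eq_bigr => i _.
  have -> : ((col_of_tuple b)^T *m (row i X)^T) 0 0 = (X *m col_of_tuple b) i 0.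
    by rewrite -trmx_mul mxE -row_mul mxE.
  set u := (X *m _) i 0; rewrite expRN expR_softplus /sigmoid /sgn.
  have p0 x : 1 + expR x != 0 :> R by rewrite gt_eqF// addr_gt0// expR_gt0.
  case: (Y i) => /=; first by rewrite expr1 expr0 mulr1 mulN1r div1r.
  rewrite expr0 expr1 !mul1r expRN -[X in X - _](mulfV (p0 u)).
  have e0 : expR u != 0 by rewrite gt_eqF// expR_gt0.
  have -> : (1 + (expR u)^-1)^-1 = expR u / (1 + expR u).
    by rewrite -[X in (X + _)^-1](mulfV e0) -{2}[(expR u)^-1]mul1r -mulrDl
      invfM invrK mulrC addrC.
  by rewrite -mulrBl addrK mul1r.
by rewrite div1r /sqnorm trmx_mul !mulmxA.
Qed.

Lemma sqnormB_combination (m : nat) (u v : 'cV[R]_m) t :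
  sqnorm ((1 - t) *: u + t *: v) =
  (1 - t) * sqnorm u + t * sqnorm v - t * (1 - t) * sqnorm (v - u).
Proof.
rewrite !sqnormE !mulr_sumr -big_split -sumrB/=; apply: eq_bigr => i _.
by rewrite !mxE; ring.
Qed.

Lemma potential_strongly_convex u v t : 0 <= t <= 1 ->
  potential ((1 - t) *: u + t *: v) <= (1 - t) * potential u + t * potential v
    - t * (1 - t) * ((2 * g)^-1 * sqnorm (X *m (v - u))).
Proof.
move=> t01; rewrite /potential mulmxDr -!scalemxAr sqnormB_combination -mulmxBr.
set N := sqnorm (X *m (v - u)).
have : \sum_i softplus (sgn i * ((1 - t) *: (X *m u) + t *: (X *m v)) i 0) <=
    (1 - t) * \sum_i softplus (sgn i * (X *m u) i 0) +
    t * \sum_i softplus (sgn i * (X *m v) i 0).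
  rewrite !mulr_sumr -big_split/=; apply: ler_sum => i _.
  apply: le_trans (softplus_convex _ _ t01).
  by rewrite le_eqVlt; apply/orP; left; apply/eqP; congr softplus; rewrite !mxE; ring.
set a1 := \sum_i _; set a2 := \sum_i _; set a3 := \sum_i _.
move=> H; rewrite -subr_ge0; rewrite -subr_ge0 in H.
apply: le_trans H _; rewrite le_eqVlt; apply/orP; left; apply/eqP.
ring.
Qed.

(** Compare [u] with the point at distance [t] on the segment to [v], divide by
    [t] and let [t] tend to zero. *)
Lemma potential_gap u v : (forall w, potential u <= potential w) ->
  (2 * g)^-1 * sqnorm (X *m (v - u)) <= potential v - potential u.
Proof.
move=> umin; set N := (2 * g)^-1 * _; set D := _ - _.
have D0 : 0 <= D by rewrite subr_ge0.
have key t : 0 < t <= 1 -> (1 - t) * N <= D.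
  move=> /andP[t0 t1]; have t01 : 0 <= t <= 1 by rewrite ltW.
  have := le_trans (umin _) (potential_strongly_convex u v t01); rewrite -/N => H.
  have : t * ((1 - t) * N) <= t * D by rewrite /D; lra.
  by rewrite ler_pM2l.
rewrite leNgt; apply/negP => DN.
have N0 : 0 < N by apply: le_lt_trans DN.
have : 0 < (N - D) / (2 * N) <= 1.
  have N2 : 0 < 2 * N by rewrite mulr_gt0.
  by apply/andP; split; [rewrite divr_gt0// subr_gt0|rewrite ler_pdivrMr//; lra].
move/key; have -> : (1 - (N - D) / (2 * N)) * N = (N + D) / 2.
  by field; rewrite gt_eqF.
lra.
Qed.

Hypothesis injX : forall v : 'cV[R]_d, X *m v = 0 -> v = 0.

Lemma gram_positive_definite : positive_definite (X^T *m X).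
Proof.
split; first by rewrite trmx_mul trmxK.
move=> v v0; rewrite mulmxA -trmx_mul -mulmxA -/(sqnorm (X *m v)).
rewrite lt_neqAle sqnorm_ge0 andbT eq_sym sqnorm_eq0.
by apply: contraNneq v0 => /injX ->.
Qed.

Lemma entry_sqnorm (m : nat) (y : 'cV[R]_m) i : `|y i 0| <= Num.sqrt (sqnorm y).
Proof.
rewrite -sqrtr_sqr; apply: ler_wsqrtr; rewrite sqnormE (bigD1 i)//= lerDl.
by apply: sumr_ge0 => j _; exact: sqr_ge0.
Qed.

(** An injective matrix has a left inverse. *)
Lemma entry_coercive : exists2 K : R, 0 <= K &
  forall (v : 'cV[R]_d) i, `|v i 0| <= K * Num.sqrt (sqnorm (X *m v)).
Proof.
have : row_free X^T.
  rewrite -kermx_eq0; apply/eqP/row_matrixP => i; rewrite row0.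
  have : row i (kermx X^T) *m X^T = 0 by rewrite -row_mul mulmx_ker row0.
  move=> /(congr1 trmx); rewrite trmx_mul trmxK trmx0 => /injX.
  by move=> /(congr1 trmx); rewrite trmxK trmx0.
move=> /row_freeP[B XB].
have BX : B^T *m X = 1%:M by rewrite -[X]trmxK -trmx_mul XB trmx1.
exists (\sum_i \sum_l `|B^T i l|).
  by apply: sumr_ge0 => i _; apply: sumr_ge0.
move=> v i; rewrite -{1}[v]mul1mx -BX -mulmxA mxE mulr_suml (bigD1 i)//=.
rewrite -[leLHS]addr0 lerD//.
  apply: le_trans (ler_norm_sum _ _ _) _; rewrite mulr_suml.
  by apply: ler_sum => l _; rewrite normrM ler_wpM2l// entry_sqnorm.
apply: sumr_ge0 => l _; rewrite mulr_ge0 ?sqrtr_ge0//.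
by apply: sumr_ge0.
Qed.

End posterior_geometry.

(** * Existence of the mode *)

Section posterior_mode.
Context (R : realType) (g : R) (n d : nat) (X : 'M[R]_(n, d)) (Y : 'I_n -> bool).
Hypothesis g0 : 0 < g.
Hypothesis injX : forall v : 'cV[R]_d, X *m v = 0 -> v = 0.

Lemma continuous_sum_fun (T : topologicalType) (m : nat) (F : 'I_m -> T -> R) :
  (forall i, continuous (F i)) -> continuous (fun t => \sum_i F i t).
Proof.
move=> cF; apply: (@continuous_big _ _ +%R 0 predT _ T (index_enum 'I_m) F).
  exact: add_continuous.
by move=> i _; exact: cF.
Qed.

Lemma continuous_softplus : continuous (@softplus R).
Proof.
rewrite (_ : @softplus R = @ln R \o (fun x => 1 + expR x))// => x.
apply: continuous_comp.
  by apply: cvgD; [exact: cvg_cst|exact: continuous_expR].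
by apply: continuous_ln; rewrite addr_gt0// expR_gt0.
Qed.

Lemma continuous_mul_fun (T : topologicalType) (f1 f2 : T -> R) :
  continuous f1 -> continuous f2 -> continuous (fun t => f1 t * f2 t).
Proof. by move=> c1 c2 t; apply: cvgM; [exact: c1|exact: c2]. Qed.

Lemma continuous_potential :
  continuous (fun w : 'rV[R]_d => potential g X Y w^T : R).
Proof.
have cst_cont (c : R) : continuous (fun _ : 'rV[R]_d => c) by exact: cst_continuous.
have cX i : continuous (fun w : 'rV[R]_d => (X *m w^T) i 0 : R).
  rewrite (_ : (fun _ => _) = fun w : 'rV[R]_d => \sum_j X i j * w 0 j).
    apply: continuous_sum_fun => j; apply: continuous_mul_fun => //.
    exact: coord_continuous.
  by apply/funext => w; rewrite mxE; apply: eq_bigr => j _; rewrite mxE.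
have c1 : continuous (fun w : 'rV[R]_d =>
    \sum_i softplus ((if Y i then -1 else 1) * (X *m w^T) i 0)).
  apply: continuous_sum_fun => i w.
  apply: (@continuous_comp _ _ _
    (fun w : 'rV[R]_d => (if Y i then -1 else 1) * (X *m w^T) i 0)
    (@softplus R)); last exact: continuous_softplus.
  exact: continuous_mul_fun.
have c2 : continuous (fun w : 'rV[R]_d => (2 * g)^-1 * sqnorm (X *m w^T)).
  apply: continuous_mul_fun => //.
  rewrite (_ : (fun _ => _) =
      fun w : 'rV[R]_d => \sum_i (X *m w^T) i 0 * (X *m w^T) i 0).
    by apply: continuous_sum_fun => i; exact: continuous_mul_fun.
  by apply/funext => v; rewrite sqnormE; apply: eq_bigr => i _; rewrite expr2.
by move=> w; exact: (cvgD (c1 w) (c2 w)).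
Qed.

Lemma potential_ge v : (2 * g)^-1 * sqnorm (X *m v) <= potential g X Y v.
Proof.
by rewrite /potential lerDr; apply: sumr_ge0 => i _; exact: softplus_ge0.
Qed.

(** Outside a large box the potential exceeds its value at zero, by coercivity of
    its quadratic part; inside the box compactness applies. *)
Lemma potential_min_exists : exists u, forall v, potential g X Y u <= potential g X Y v.
Proof.
have [K K0 coer] := entry_coercive injX.
pose f (w : 'rV[R]_d) : R := potential g X Y w^T.
pose S := Num.sqrt (2 * g * potential g X Y 0).
pose A := [set w : 'rV[R]_d | forall i, `[(- (K * S)), (K * S)]%classic (w ord0 i)].
have KS0 : 0 <= K * S by rewrite mulr_ge0// sqrtr_ge0.
have A0 : A 0 by move=> i /=; rewrite mxE in_itv/= oppr_le0 KS0.
have cA : compact A.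
  exact: (@rV_compact R d (fun=> `[(- (K * S)), (K * S)]%classic)
    (fun i => @segment_compact R _ _)).
have [u uA umin] := EVT_min_rV (ex_intro _ _ A0) cA
  (continuous_subspaceT continuous_potential).
exists u^T => v.
have [vA|/existsNP[i vi]] := pselect (A v^T).
  by have := umin v^T; rewrite trmxK; apply; exact: mem_set.
have u0 : f u <= f 0 by apply: umin; exact: mem_set.
apply: (le_trans u0); rewrite /f trmx0.
have vS : S < Num.sqrt (sqnorm (X *m v)).
  rewrite ltNge; apply/negP => vS; apply: vi; rewrite /= mxE in_itv/= -ler_norml.
  by apply: le_trans (coer v i) _; rewrite ler_wpM2l.
have p0 : 0 <= potential g X Y 0.
  apply: le_trans (potential_ge 0); rewrite mulr_ge0 ?sqnorm_ge0// invr_ge0.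
  by rewrite mulr_ge0// ltW.
apply: le_trans (potential_ge v).
rewrite mulrC ler_pdivlMr ?mulr_gt0// mulrC.
have : 0 <= 2 * g * potential g X Y 0 by rewrite !mulr_ge0// ltW.
move=> q0; rewrite -(sqr_sqrtr q0) -[leRHS](sqr_sqrtr (sqnorm_ge0 _)).
by apply: lerXn2r; rewrite ?nnegrE ?sqrtr_ge0// ltW.
Qed.

End posterior_mode.

(** * Acceptance probability at the mode *)

Section mode_acceptance.
Context (R : realType) (g h : R) (n d : nat) (X : 'M[R]_(n, d)) (Y : 'I_n -> bool).
Hypotheses (g0 : 0 < g) (h0 : 0 < h).

Lemma measurable_col_of_tuple :
  measurable_mx (@col_of_tuple R d : d.-tuple R -> 'cV[R]_d).
Proof. by move=> i j; under eq_fun do rewrite mxE; exact: measurable_tnth. Qed.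

Lemma measurable_unnormalized_posterior :
  measurable_fun [set: d.-tuple R] (unnormalized_posterior g X Y).
Proof.
rewrite (_ : unnormalized_posterior g X Y =
    fun b => expR (- potential g X Y (col_of_tuple b))); last first.
  by apply/funext => b; exact: unnormalized_posteriorE.
have mX : measurable_mx (fun b : d.-tuple R => X *m col_of_tuple b).
  by apply: measurable_mxM; [exact: measurable_mx_cst|exact: measurable_col_of_tuple].
apply: measurableT_comp => //; apply: measurableT_comp => //.
apply: measurable_funD; last by apply: measurable_funM => //; exact: measurable_sqnorm.
apply: measurable_sum => i.
apply: (measurableT_comp (continuous_measurable_fun (@continuous_softplus R))).
exact: measurable_funM.
Qed.

Lemma integral_gaussian_pdf_le1 (k : R) (m : d.-tuple R) : 0 < k ->
  (\int[lebesgue_tuple R d]_z (gaussian_pdf m k z)%:E <= 1)%E.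
Proof.
move=> k0; pose s : seq 'cV[R]_0 := nseq d 0.
(* The quadratic bound with a vanishing form and columns of height zero. *)
have := gaussian_quadratic_bound k0 m (0 : 'cV[R]_0) (lexx 0) (size_nseq d 0 : size s = d).
have -> : volume_factor k 0 s = 1.
  elim: s => //= x s ->.
  by rewrite mul0r mulr0 addr0 sqrtr1 invr1 mulr1.
rewrite !mul0r oppr0 expR0 mulr1; apply: le_trans.
rewrite le_eqVlt; apply/orP; left; apply/eqP; apply: eq_integral => z _.
by rewrite !mul0r oppr0 expR0 mul1r.
Qed.

Lemma lebesgue_tupleT_neq0 : lebesgue_tuple R d [set: d.-tuple R] != 0%E.
Proof.
apply/eqP => T0.
have := @lebesgue_tuple_box R d (fun=> `[0, 1]%classic) (fun=> measurable_itv _).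
rewrite big1 => [H|i _]; last first.
  by rewrite /= lebesgue_measure_itv/= lte_fin ltr01 oppr0 adde0.
have : (lebesgue_tuple R d [set t | forall i, `[0%R, 1%R]%classic (tnth t i)] <=
    lebesgue_tuple R d [set: d.-tuple R])%E.
  apply: le_measure => //; rewrite inE//.
  rewrite (_ : [set _ | _] = \bigcap_(i in [set: 'I_d]) ((@tnth d R ^~ i) @^-1` `[0, 1]%classic)).
    apply: fin_bigcap_measurable => [|i _]; first exact: finite_finset.
    by rewrite -[X in measurable X]setTI; apply: measurable_tnth.
  by apply/seteqP; split => t /= Ht i; [move=> _|]; exact: Ht.
by rewrite T0 H lee_fin ler10.
Qed.

Hypothesis injX : forall v : 'cV[R]_d, X *m v = 0 -> v = 0.

Let U := unnormalized_posterior g X Y.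

Lemma unnormalized_posterior_gt0 b : 0 < U b.
Proof. by rewrite /U unnormalized_posteriorE expR_gt0. Qed.

(** The real-valued integral is zero if the extended one is infinite, so finiteness
    is at stake too: by coercivity the integrand is at most a multiple of a
    Gaussian density. *)
Lemma normalizing_constant_gt0 : 0 < (\int[lebesgue_tuple R d]_b U b)%R.
Proof.
have mU : measurable_fun [set: d.-tuple R] (fun b => (U b)%:E).
  by apply/measurable_EFinP; exact: measurable_unnormalized_posterior.
have U0 b : (0 <= (U b)%:E)%E by rewrite lee_fin ltW// unnormalized_posterior_gt0.
have I0 : (0 <= \int[lebesgue_tuple R d]_b (U b)%:E)%E by exact: integral_ge0.
rewrite /Rintegral fine_gt0//; apply/andP; split.
  rewrite lt_neqAle I0 andbT eq_sym; apply/eqP => Z0.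
  have : (\int[lebesgue_tuple R d]_b `|(U b)%:E| = 0)%E.
    by rewrite -[RHS]Z0; apply: eq_integral => b _; rewrite gee0_abs.
  move/(ae_eq_integral_abs _ measurableT mU) => [N [mN N0 sub]].
  have /negP := lebesgue_tupleT_neq0; apply; apply/eqP.
  apply: (subset_measure0 _ mN _ N0) => // b _; apply: sub => /= /(_ I).
  by apply/eqP; rewrite eqe gt_eqF// unnormalized_posterior_gt0.
have [K K0 coer] := entry_coercive injX.
pose kappa := d%:R * K ^+ 2 + 1.
have kappa0 : 0 < kappa by rewrite ltr_wpDl// mulr_ge0// sqr_ge0.
have gk : 0 < g * kappa by rewrite mulr_gt0.
pose z0 : d.-tuple R := [tuple 0 | i < d].
pose c0 : R := (2 * pi * (g * kappa)) `^ (- (d%:R / 2)).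
have c00 : 0 < c0 by rewrite powR_gt0// !mulr_gt0// pi_gt0.
have Ub b : U b <= c0^-1 * gaussian_pdf z0 (g * kappa) b.
  rewrite /gaussian_pdf -/c0 [leRHS]mulrA mulVf ?gt_eqF// mul1r /U unnormalized_posteriorE.
  rewrite ler_expR lerN2; apply: (le_trans _ (potential_ge g X Y (col_of_tuple b))).
  set v := col_of_tuple b; have Sb : \sum_(j < d) (tnth b j - tnth z0 j) ^+ 2 <=
      kappa * sqnorm (X *m v).
    apply: (@le_trans _ _ (\sum_(j < d) K ^+ 2 * sqnorm (X *m v))).
      apply: ler_sum => j _; rewrite tnth_mktuple subr0.
      have := coer v j; rewrite mxE => bj.
      rewrite -[in leRHS](sqr_sqrtr (sqnorm_ge0 (X *m v))) -exprMn -[leLHS]real_normK ?num_real//.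
      by apply: lerXn2r => //; rewrite nnegrE// mulr_ge0// sqrtr_ge0.
    rewrite sumr_const card_ord -[leLHS]mulr_natl mulrA ler_wpM2r ?sqnorm_ge0//.
    by rewrite lerDl.
  rewrite ler_pdivrMr ?mulr_gt0//; apply: le_trans Sb _.
  rewrite le_eqVlt; apply/orP; left; apply/eqP; field.
  by rewrite gt_eqF.
apply: (@le_lt_trans _ _ (\int[lebesgue_tuple R d]_b
   ((c0^-1)%:E * (gaussian_pdf z0 (g * kappa) b)%:E))%E).
  apply: ge0_le_integral => // [|b _].
  - apply/measurable_EFinP; apply: measurable_funM => //.
    exact: measurable_gaussian_pdf.
  - by rewrite -EFinM lee_fin.
rewrite ge0_integralZl_EFin//; first last.
- by rewrite invr_ge0 ltW.
- by apply/measurable_EFinP; exact: measurable_gaussian_pdf.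
- by move=> b _; rewrite lee_fin gaussian_pdf_ge0.
apply: (@le_lt_trans _ _ ((c0^-1)%:E * 1)%E); last by rewrite mule1 ltry.
apply: lee_wpmul2l; first by rewrite lee_fin invr_ge0 ltW.
exact: integral_gaussian_pdf_le1.
Qed.

Definition tuple_of_col (v : 'cV[R]_d) : d.-tuple R := [tuple v i 0 | i < d].

Lemma tuple_of_colK : cancel tuple_of_col (@col_of_tuple R d).
Proof. by move=> v; apply/colP => i; rewrite mxE tnth_mktuple. Qed.

Lemma col_of_tupleK : cancel (@col_of_tuple R d) tuple_of_col.
Proof. by move=> b; apply: eq_from_tnth => i; rewrite tnth_mktuple mxE. Qed.

Lemma posterior_maximizesP b : maximizes (posterior g X Y) b <->
  forall v, potential g X Y (col_of_tuple b) <= potential g X Y v.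
Proof.
have Z0 := normalizing_constant_gt0.
have le b1 b2 : (posterior g X Y b1 <= posterior g X Y b2) =
    (potential g X Y (col_of_tuple b2) <= potential g X Y (col_of_tuple b1)).
  by rewrite /posterior ler_pM2r ?invr_gt0// !unnormalized_posteriorE ler_expR lerN2.
split=> [bmax v|bmin b']; last by rewrite le.
by rewrite -[v]tuple_of_colK -le.
Qed.

Lemma exists_unique_mode : exists! b, maximizes (posterior g X Y) b.
Proof.
have [u umin] := potential_min_exists Y g0 injX.
exists (tuple_of_col u); split.
  by apply/posterior_maximizesP; rewrite tuple_of_colK.
move=> b /posterior_maximizesP bmin.
rewrite -[b]col_of_tupleK; congr tuple_of_col; apply/eqP.
rewrite eq_sym -subr_eq0; apply/eqP/injX/eqP; rewrite -sqnorm_eq0 eq_le sqnorm_ge0 andbT.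
have := potential_gap (col_of_tuple b) umin.
have : potential g X Y (col_of_tuple b) - potential g X Y u <= 0 by rewrite subr_le0.
move=> /[swap] /le_trans /[apply].
by rewrite pmulr_rle0// invr_gt0 mulr_gt0.
Qed.

Variable s : seq 'cV[R]_n.
Hypotheses (size_s : size s = d) (col_s : forall i, col i X = nth 0 s i).

Lemma displacementE (b b' : d.-tuple R) :
  displacement s b b' = X *m (col_of_tuple b' - col_of_tuple b).
Proof.
apply/colP => i; rewrite /displacement summxE mxE; apply: eq_bigr => j _.
by rewrite -col_s !mxE mulrC.
Qed.

(** The normalizing constant cancels in the ratio, which [potential_gap] bounds by
    the exponential of a quadratic form in the proposed move. *)
Lemma acceptance_at_mode b : maximizes (posterior g X Y) b ->
  (rwmh_acceptance h (posterior g X Y) b <= (volume_factor h g^-1 s)%:E)%E.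
Proof.
move=> /posterior_maximizesP bmin; rewrite /rwmh_acceptance.
have Z0 := normalizing_constant_gt0.
have := gaussian_quadratic_bound h0 b (0 : 'cV[R]_n) (_ : 0 <= g^-1) size_s.
rewrite invr_ge0 ltW// mulmx0 => /(_ isT).
have -> : sqnorm (0 : 'cV[R]_n) = 0 by apply/eqP; rewrite sqnorm_eq0.
rewrite mulr0 oppr0 expR0 mulr1; apply: le_trans.
have ratio b' : posterior g X Y b' / posterior g X Y b <=
    expR (- (g^-1 / 2 * sqnorm (0 + displacement s b b'))).
  rewrite /posterior invfM invrK mulrACA mulVf ?gt_eqF// mulr1.
  rewrite !unnormalized_posteriorE -expRN -expRD ler_expR opprK addrC -lerN2 opprK opprB.
  have := potential_gap (col_of_tuple b') bmin.
  by rewrite add0r displacementE invfM [g^-1 / 2]mulrC.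
apply: ge0_le_integral => //.
- move=> b' _; rewrite lee_fin mulr_ge0 ?gaussian_pdf_ge0//.
  by rewrite le_min ler01 andbT divr_ge0// divr_ge0 ?ltW// unnormalized_posterior_gt0.
- apply/measurable_EFinP; apply: measurable_funM; last exact: measurable_gaussian_pdf.
  apply: measurable_minr => //; apply: measurable_funM => //.
  by apply: measurable_funM => //; exact: measurable_unnormalized_posterior.
- apply/measurable_EFinP; apply: measurable_funM; last exact: measurable_gaussian_pdf.
  apply: measurableT_comp => //; apply: measurableT_comp => //.
  by apply: measurable_funM => //; exact: measurable_sqnorm_displacement.
- move=> b' _; rewrite lee_fin ler_wpM2r ?gaussian_pdf_ge0//.
  by rewrite ge_min ratio.
Qed.

End mode_acceptance.

(** * Decoupling independent coordinates *)

Section decoupling.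
Context (R : realType) (I : choiceType).

(** Finite-dimensional cylinders.  They form a pi-system on which mutual
    independence prescribes the law of the whole family. *)
Definition cylinder : set (set (I -> R)) :=
  [set A | exists (J : {fset I}) (B : I -> set R),
     (forall i, measurable (B i)) /\
     A = \bigcap_(i in [set` J]) (fun x : I -> R => x i) @^-1` B i].

Definition array := g_sigma_algebraType cylinder.

HB.instance Definition _ := Measurable.copy array (g_sigma_algebraType cylinder).

Lemma measurable_coord (i : I) :
  measurable_fun [set: array] (fun x : array => x i : R).
Proof.
move=> _ B mB; rewrite setTI; apply: sub_sigma_algebra.
exists [fset i]%fset, (fun=> B); split => //.
apply/seteqP; split => x /=; first by move=> Bx j /=; rewrite inE => /eqP ->.
by move=> H; apply: H; rewrite /= inE.
Qed.

Lemma measurable_array d (T : measurableType d) (f : T -> array) :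
  (forall i, measurable_fun [set: T] (fun t => f t i : R)) ->
  measurable_fun [set: T] f.
Proof.
move=> mf; apply: (@measurability _ _ T array setT f cylinder) => //.
move=> _ [_ [J [B [mB ->]]] <-]; rewrite setTI preimage_bigcap.
apply: fin_bigcap_measurable => // i _.
by rewrite -[X in measurable X]setTI; exact: mf.
Qed.

Lemma setI_closed_cylinder : setI_closed cylinder.
Proof.
move=> _ _ [J [B [mB ->]]] [K [C [mC ->]]].
exists (J `|` K)%fset,
  (fun i => (if i \in J then B i else setT) `&` (if i \in K then C i else setT)).
split; first by move=> i; apply: measurableI; case: ifP.
apply/seteqP; split => x /=.
  by move=> [H1 H2] i _ /=; split; case: ifPn => // h; [exact: H1|exact: H2].
move=> H; split => i /= iJ.
  by have := H i; rewrite /= inE iJ => /(_ isT) [].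
by have := H i; rewrite /= inE iJ orbT => /(_ isT) [].
Qed.

Context (dsp : measure_display) (Omega : measurableType dsp).
Context (P : probability Omega R) (X : I -> {RV P >-> R}).

Definition sample (w : Omega) : array := fun i => X i w.

(** Two independent copies of the family, merged along [S]. *)
Definition mix (S : pred I) (w : Omega * Omega) : array :=
  fun i => if S i then X i w.1 else X i w.2.

Lemma measurable_sample : measurable_fun setT sample.
Proof. by apply: measurable_array => i; exact: measurable_funPT. Qed.

Lemma measurable_mix S : measurable_fun setT (mix S).
Proof.
apply: measurable_array => i; rewrite /mix; case: (S i);
  by apply: measurableT_comp => //; exact: measurable_funPT.
Qed.

Hypothesis indep : mutually_independent X.

(** Both laws give a cylinder the product of the probabilities of its sides: for the
    merged family, each coordinate is constrained in exactly one of the copies. *)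
Lemma mix_law (S : pred I) (A : set array) : measurable A ->
  (P \x P)%E (mix S @^-1` A) = P (sample @^-1` A).
Proof.
move=> mA.
pose nu1 : {measure set array -> \bar R} :=
  measure_function_pushforward__canonical__measure_function_Measure
    (P \x P)%E (measurable_mix S).
pose nu2 : {measure set array -> \bar R} :=
  measure_function_pushforward__canonical__measure_function_Measure
    P measurable_sample.
rewrite -[LHS]/(nu1 A) -[RHS]/(nu2 A).
apply: (@measure_unique _ R array cylinder (fun=> setT) _ _ _ _ nu1 nu2) => //.
- exact: setI_closed_cylinder.
- move=> _; exists fset0, (fun=> setT); split => //.
  by apply/seteqP; split.
- by rewrite bigcup_const//; exists 0%N.
- move=> _ [J [B [mB ->]]].
  rewrite /nu1 /nu2 /= /pushforward.
  have -> : sample @^-1` (\bigcap_(i in [set` J]) (fun x : I -> R => x i) @^-1` B i)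
    = \bigcap_(i in [set` J]) X i @^-1` B i by rewrite preimage_bigcap.
  rewrite indep//.
  pose B1 i := if S i then B i else setT.
  pose B2 i := if S i then setT else B i.
  have mB1 i : measurable (B1 i) by rewrite /B1; case: ifP.
  have mB2 i : measurable (B2 i) by rewrite /B2; case: ifP.
  have -> : mix S @^-1` (\bigcap_(i in [set` J]) (fun x : I -> R => x i) @^-1` B i)
    = (\bigcap_(i in [set` J]) X i @^-1` B1 i) `*` (\bigcap_(i in [set` J]) X i @^-1` B2 i).
    apply/seteqP; split => -[w w'] /=; rewrite /mix /B1 /B2.
      by move=> H; split => i iJ; have := H i iJ; rewrite /preimage/=; case: (S i).
    by move=> [H1 H2] i iJ; have := H1 i iJ; have := H2 i iJ;
      rewrite /preimage/=; case: (S i).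
  have mX C : (forall i, measurable (C i)) ->
      measurable (\bigcap_(i in [set` J]) X i @^-1` C i).
    move=> mC; apply: fin_bigcap_measurable => // i _.
    by rewrite -[X in measurable X]setTI; exact: measurable_funPT.
  rewrite product_measure1E; [|exact: mX mB1|exact: mX mB2].
  rewrite [X in (X * _)%E](indep J mB1) [X in (_ * X)%E](indep J mB2) -big_split/=.
  apply: eq_bigr => i _; rewrite /B1 /B2; case: (S i).
    by rewrite preimage_setT probability_setT mule1.
  by rewrite preimage_setT probability_setT mul1e.
- move=> _; rewrite /nu1 /= /pushforward preimage_setT -setXTT.
  by rewrite product_measure1E// -[X in (X < _)%E]/(P setT * P setT)%E probability_setT mule1 ltry.
Qed.

Lemma decoupling (S : pred I) (G : array -> \bar R) :
  measurable_fun [set: array] G -> (forall x, 0 <= G x)%E ->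
  (\int[P]_w G (sample w) = \int[P]_w \int[P]_w' G (mix S (w, w')))%E.
Proof.
move=> mG G0.
rewrite -(fubini_tonelli1 (fun w => G (mix S w)))//; last first.
  by apply: measurableT_comp => //; exact: measurable_mix.
have := @ge0_integral_pushforward _ _ _ _ R _ measurable_sample P setT G measurableT mG.
rewrite preimage_setT => <-; last by move=> *.
have := @ge0_integral_pushforward _ _ _ _ R _ (measurable_mix S) (P \x P)%E setT G measurableT mG.
rewrite preimage_setT => <-; last by move=> *.
apply: eq_measure_integral;
  [exact: measurable_mix|exact: measurable_sample|move=> m1 m2 A mA _].
by rewrite /= /pushforward -(mix_law S).
Qed.

(** The only form in which independence of blocks of coordinates is used: the
    part of an integrand that depends on the coordinates in [S] and the part that
    depends on the others may be evaluated at independent outcomes. *)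
Lemma decouple (S : pred I) (H : array -> array -> \bar R) :
  measurable_fun [set: array] (fun x => H x x) ->
  (forall x y, 0 <= H x y)%E ->
  (forall x x' y y' : array, (forall i, S i -> x i = x' i) ->
     (forall i, ~~ S i -> y i = y' i) -> H x y = H x' y') ->
  (\int[P]_w H (sample w) (sample w) =
   \int[P]_w \int[P]_w' H (sample w) (sample w'))%E.
Proof.
move=> mH H0 HS; rewrite (decoupling S mH)//.
apply: eq_integral => w _; apply: eq_integral => w' _.
by apply: HS => i; rewrite /mix; [move=> ->|move=> /negbTE ->].
Qed.

End decoupling.

(** * Moments of the entries *)

Section moments.
Context (R : realType) (dsp : measure_display) (Omega : measurableType dsp).
Context (P : probability Omega R).
Local Open Scope ereal_scope.

Record standardized (k : R) (Z : Omega -> R) : Prop := Standardized {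
  std_measurable : measurable_fun [set: Omega] Z;
  std_mean : \int[P]_w (Z w)%:E = 0;
  std_second : \int[P]_w (Z w ^+ 2)%:E = 1;
  std_fourth : \int[P]_w (Z w ^+ 4)%:E <= k%:E }.

Lemma integral_probability_cst (c : R) : \int[P]_w c%:E = c%:E.
Proof. by have := expectation_cst P c; rewrite unlock. Qed.

Lemma integral_le_mono (f1 f2 : Omega -> \bar R) :
  (forall w, 0 <= f1 w) -> measurable_fun [set: Omega] f1 ->
  measurable_fun [set: Omega] f2 -> (forall w, f1 w <= f2 w) ->
  \int[P]_w f1 w <= \int[P]_w f2 w.
Proof. by move=> f10 m1 m2 f12; apply: ge0_le_integral. Qed.

Lemma integrable_pow4 (Z : Omega -> R) : measurable_fun [set: Omega] Z ->
  \int[P]_w (Z w ^+ 4)%:E < +oo ->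
  forall j, (j <= 4)%N -> P.-integrable setT (fun w => (Z w ^+ j)%:E).
Proof.
move=> mZ Z4 j j4.
have I4 : P.-integrable setT (fun w => (Z w ^+ 4)%:E).
  apply/integrableP; split; first by apply/measurable_EFinP; exact: measurable_funX.
  under eq_integral do rewrite gee0_abs ?lee_fin ?exprn_even_ge0//.
  by [].
have I1 : P.-integrable setT (fun w => (1 + Z w ^+ 4)%:E).
  apply: (@eq_integrable _ _ _ P _ measurableT (fun w => (cst 1 w + (Z w ^+ 4)%:E))).
    by move=> w _.
  by apply: integrableD => //; exact: finite_measure_integrable_cst.
apply: (le_integrable measurableT _ _ I1).
  by apply/measurable_EFinP; exact: measurable_funX.
move=> w _; rewrite !abse_EFin lee_fin normrX [leRHS]ger0_norm; last first.
  by rewrite addr_ge0// exprn_even_ge0.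
have -> : (Z w ^+ 4 = `|Z w| ^+ 4)%R by rewrite -normrX ger0_norm// exprn_even_ge0.
have [z1|z1] := lerP `|Z w| 1.
  rewrite (le_trans (exprn_ile1 _ _ _))// lerDl exprn_ge0//.
by rewrite (le_trans (ler_weXn2l (ltW z1) j4))// lerDr.
Qed.

(** The cubic term is left out because [chaos_second_moment] bounds the one cross
    term of degree three by squares before integrating. *)
Lemma integral_quartic (k : R) (Z : Omega -> R) (c0 c1 c2 c4 : R) :
  standardized k Z -> (0 <= c4)%R ->
  \int[P]_w (c0 + c1 * Z w + c2 * Z w ^+ 2 + c4 * Z w ^+ 4)%:E <=
  (c0 + c2 + c4 * k)%:E.
Proof.
move=> [mZ Z1 Z2 Z4] c40.
have I : forall j, (j <= 4)%N -> P.-integrable setT (fun w => (Z w ^+ j)%:E).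
  by apply: integrable_pow4 => //; rewrite (le_lt_trans Z4)// ltry.
have IZ c j : (j <= 4)%N -> P.-integrable setT (fun w => (c * Z w ^+ j)%:E).
  move=> j4; apply: (@eq_integrable _ _ _ P _ measurableT (fun w => c%:E * (Z w ^+ j)%:E)) => //.
  by apply: integrableZl => //; exact: I.
have -> : \int[P]_w (c0 + c1 * Z w + c2 * Z w ^+ 2 + c4 * Z w ^+ 4)%:E =
    \int[P]_w ((c0 * Z w ^+ 0)%:E + (c1 * Z w ^+ 1)%:E + (c2 * Z w ^+ 2)%:E
     + (c4 * Z w ^+ 4)%:E).
  by apply: eq_integral => w _; rewrite expr0 mulr1 expr1 -!EFinD.
rewrite integralD//; [|by do ?apply: integrableD => //; apply: IZ|exact: IZ].
rewrite integralD//; [|by do ?apply: integrableD => //; apply: IZ|exact: IZ].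
rewrite integralD//; [|exact: IZ|exact: IZ].
have E c j : (j <= 4)%N -> \int[P]_w (c * Z w ^+ j)%:E = c%:E * \int[P]_w (Z w ^+ j)%:E.
  by move=> j4; rewrite -integralZl//; exact: I.
rewrite !E// Z2 mule1.
have -> : \int[P]_w (Z w ^+ 1)%:E = 0 by under eq_integral do rewrite expr1.
have -> : \int[P]_w (Z w ^+ 0)%:E = 1.
  by under eq_integral do rewrite expr0; exact: integral_probability_cst.
rewrite mule1 mule0 adde0 !EFinD EFinM leeD2l//.
by apply: lee_wpmul2l; rewrite ?lee_fin.
Qed.

End moments.

(** * Variance of a quadratic form in independent variables *)

Section quadratic_forms.
Context (R : realType) (I : choiceType).
Context (dsp : measure_display) (Omega : measurableType dsp).
Context (P : probability Omega R) (X : I -> {RV P >-> R}).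
Hypothesis indep : mutually_independent X.
Variable k : R.
Hypothesis stdX : forall i, standardized P k (X i).

Lemma fourth_moment_ge0 (i : I) : 0 <= k.
Proof.
rewrite -lee_fin; apply: le_trans (std_fourth (stdX i)).
by apply: integral_ge0 => w _; rewrite lee_fin exprn_even_ge0.
Qed.

Variable e : nat -> I.
Hypothesis inj_e : injective e.

Lemma agree_lt (m l : nat) : (l < m)%N -> e l != e m.
Proof. by move=> lm; apply/eqP => /inj_e lm'; rewrite lm' ltnn in lm. Qed.

Definition lin (m : nat) (b : nat -> R) (x : array R I) : R :=
  \sum_(l < m) b l * x (e l).

Lemma measurable_lin m b : measurable_fun [set: array R I] (lin m b).
Proof.
apply: measurable_sum => i; apply: measurable_funM => //.
exact: measurable_coord.
Qed.

Lemma eq_lin m b (x y : array R I) :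
  (forall i, i != e m -> x i = y i) -> lin m b x = lin m b y.
Proof. by move=> xy; apply: eq_bigr => i _; rewrite xy// agree_lt. Qed.

(** The last variable is decoupled from the others and integrated first; being
    centered, it has no cross term. *)
Lemma lin_second_moment m b :
  (\int[P]_w (lin m b (sample X w) ^+ 2)%:E <= (\sum_(l < m) b l ^+ 2)%:E)%E.
Proof.
elim: m => [|m IH].
  rewrite big_ord0 (_ : (fun _ => _) = cst 0%E) ?integral0//.
  by apply/funext => w; rewrite /lin big_ord0 expr0n.
pose H (x y : array R I) : \bar R := ((lin m b x + b m * y (e m)) ^+ 2)%:E.
have mH : measurable_fun [set: array R I] (fun x => H x x).
  apply/measurable_EFinP; apply: measurable_funX; apply: measurable_funD.
    exact: measurable_lin.
  by apply: measurable_funM => //; exact: measurable_coord.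
rewrite (_ : (fun w => _) = fun w => H (sample X w) (sample X w)); last first.
  by apply/funext => w; rewrite /H /lin big_ord_recr.
rewrite (decouple indep (S := fun i => i != e m))//; first last.
- move=> x x' y y' Sx Sy; rewrite /H (eq_lin b Sx) (Sy (e m))//.
  by rewrite eqxx.
- by move=> x y; rewrite lee_fin exprn_even_ge0.
have mL : measurable_fun [set: Omega] (fun w => lin m b (sample X w)).
  apply: measurableT_comp; [exact: measurable_lin|exact: measurable_sample].
rewrite big_ord_recr/=.
apply: (@le_trans _ _ (\int[P]_w ((lin m b (sample X w) ^+ 2)%:E + (b m ^+ 2)%:E))%E).
  apply: integral_le_mono => [w|||w].
  - by apply: integral_ge0 => w' _; rewrite lee_fin exprn_even_ge0.
  - apply: (measurable_fun_fubini_tonelli_F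
      (fun z : Omega * Omega => H (sample X z.1) (sample X z.2))).
    + apply/measurable_EFinP; apply: measurable_funX; apply: measurable_funD.
        apply: (measurableT_comp mL) => //.
      by apply: measurable_funM => //; apply: measurableT_comp => //;
         exact: measurable_funPT.
    + by move=> z; rewrite lee_fin exprn_even_ge0.
  - by apply: emeasurable_funD => //; apply/measurable_EFinP; exact: measurable_funX.
  - set s := lin m b (sample X w).
    rewrite -EFinD.
    have := integral_quartic (s ^+ 2) (2 * s * b m) (b m ^+ 2) (stdX (e m)) (lexx 0).
    rewrite mul0r addr0; apply: le_trans; rewrite le_eqVlt; apply/orP; left; apply/eqP.
    by apply: eq_integral => w' _; rewrite /H; congr EFin; rewrite /sample -/s; ring.
rewrite ge0_integralD//; first last.
- by move=> w _; rewrite lee_fin exprn_even_ge0.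
- by apply/measurable_EFinP; exact: measurable_funX.
- by move=> w _; rewrite lee_fin exprn_even_ge0.
by rewrite integral_probability_cst EFinD leeD2r.
Qed.

(** The value at [x] of the quadratic form with symmetric coefficients [a], minus
    its trace, written as a sum of martingale differences. *)
Definition chaos (m : nat) (a : nat -> nat -> R) (x : array R I) : R :=
  \sum_(i < m) (a i i * (x (e i) ^+ 2 - 1) + 2 * x (e i) * lin i (a i) x).

Lemma measurable_chaos m a : measurable_fun [set: array R I] (chaos m a).
Proof.
apply: measurable_sum => i; apply: measurable_funD.
  apply: measurable_funM => //; apply: measurable_funB => //.
  by apply: measurable_funX; exact: measurable_coord.
apply: measurable_funM; last exact: measurable_lin.
by apply: measurable_funM => //; exact: measurable_coord.
Qed.

Lemma eq_chaos m a (x y : array R I) :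
  (forall i, i != e m -> x i = y i) -> chaos m a x = chaos m a y.
Proof.
move=> xy; apply: eq_bigr => i _; rewrite xy ?agree_lt//; congr (_ + _ * _).
by apply: eq_bigr => j _; rewrite xy// agree_lt// (ltn_trans (ltn_ord j)).
Qed.

(** Given the previous variables, the last summand is centered; its square is
    bounded by twice the squares of its two parts. *)
Lemma chaos_second_moment m a :
  (\int[P]_w (chaos m a (sample X w) ^+ 2)%:E <=
   ((2 * k + 8) * \sum_(i < m) (a i i ^+ 2 + \sum_(l < i) a i l ^+ 2))%:E)%E.
Proof.
elim: m => [|m IH].
  rewrite big_ord0 mulr0 (_ : (fun _ => _) = cst 0%E) ?integral0//.
  by apply/funext => w; rewrite /chaos big_ord0 expr0n.
pose H (x y : array R I) : \bar R :=
  ((chaos m a x + (a m m * (y (e m) ^+ 2 - 1) + 2 * y (e m) * lin m (a m) x)) ^+ 2)%:E.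
have mC : measurable_fun [set: Omega] (fun w => chaos m a (sample X w)).
  apply: measurableT_comp; [exact: measurable_chaos|exact: measurable_sample].
have mL : measurable_fun [set: Omega] (fun w => lin m (a m) (sample X w)).
  apply: measurableT_comp; [exact: measurable_lin|exact: measurable_sample].
have mH : measurable_fun [set: array R I] (fun x => H x x).
  apply/measurable_EFinP; apply: measurable_funX; apply: measurable_funD.
    exact: measurable_chaos.
  apply: measurable_funD.
    apply: measurable_funM => //; apply: measurable_funB => //.
    by apply: measurable_funX; exact: measurable_coord.
  apply: measurable_funM; last exact: measurable_lin.
  by apply: measurable_funM => //; exact: measurable_coord.
rewrite (_ : (fun w => _) = fun w => H (sample X w) (sample X w)); last first.
  by apply/funext => w; rewrite /H /chaos big_ord_recr.
rewrite (decouple indep (S := fun i => i != e m))//; first last.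
- move=> x x' y y' Sx Sy; rewrite /H (eq_lin _ Sx) (eq_chaos _ Sx) (Sy (e m))//.
  by rewrite eqxx.
- by move=> x y; rewrite lee_fin exprn_even_ge0.
pose K := 2 * a m m ^+ 2 * k.
apply: (@le_trans _ _ (\int[P]_w ((chaos m a (sample X w) ^+ 2)%:E +
   (8 * lin m (a m) (sample X w) ^+ 2)%:E + K%:E))%E).
  apply: integral_le_mono => [w|||w].
  - by apply: integral_ge0 => w' _; rewrite lee_fin exprn_even_ge0.
  - apply: (measurable_fun_fubini_tonelli_F
      (fun z : Omega * Omega => H (sample X z.1) (sample X z.2))).
    + have mX2 : measurable_fun [set: Omega * Omega] (fun z => sample X z.2 (e m)).
        by apply: measurableT_comp => //; exact: measurable_funPT.
      apply/measurable_EFinP; apply: measurable_funX; apply: measurable_funD.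
        exact: (measurableT_comp mC).
      apply: measurable_funD.
        apply: measurable_funM => //; apply: measurable_funB => //.
        exact: measurable_funX.
      apply: measurable_funM; last exact: (measurableT_comp mL).
      exact: measurable_funM.
    + by move=> z; rewrite lee_fin exprn_even_ge0.
  - apply: emeasurable_funD => //; apply: emeasurable_funD; apply/measurable_EFinP.
      exact: measurable_funX.
    by apply: measurable_funM => //; exact: measurable_funX.
  - set s := chaos m a (sample X w); set l := lin m (a m) (sample X w).
    set A := a m m in K *.
    rewrite -!EFinD.
    have c4 : 0 <= 2 * A ^+ 2 by rewrite mulr_ge0// exprn_even_ge0.
    have := integral_quartic (s ^+ 2 - 2 * s * A + 2 * A ^+ 2) (4 * s * l)
      (2 * s * A - 4 * A ^+ 2 + 8 * l ^+ 2) (stdX (e m)) c4.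
    move=> Hq; apply: (@le_trans _ _ _ _ _ (le_trans _ Hq)); last first.
      by rewrite lee_fin /K; have := exprn_even_ge0 A (isT : ~~ odd 2); lra.
    apply: integral_le_mono.
    + by move=> w'; rewrite lee_fin exprn_even_ge0.
    + have mX2 : measurable_fun [set: Omega] (fun z => sample X z (e m)).
        exact: measurable_funPT.
      apply/measurable_EFinP; apply: measurable_funX; apply: measurable_funD => //.
      apply: measurable_funD.
        apply: measurable_funM => //; apply: measurable_funB => //.
        exact: measurable_funX.
      by apply: measurable_funM => //; exact: measurable_funM.
    + have mX2 := std_measurable (stdX (e m)).
      apply/measurable_EFinP; do !apply: measurable_funD => //.
      - exact: measurable_funM.
      - by apply: measurable_funM => //; exact: measurable_funX.
      - by apply: measurable_funM => //; exact: measurable_funX.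
    + move=> w'; rewrite lee_fin /sample -/s -/l -/A.
      set x := X (e m) w'.
      rewrite -subr_ge0.
      rewrite (_ : _ - _ = (A * (x ^+ 2 - 1) - 2 * x * l) ^+ 2); last by ring.
      by rewrite exprn_even_ge0.
have m1 : measurable_fun [set: Omega] (fun w => (chaos m a (sample X w) ^+ 2)%:E).
  by apply/measurable_EFinP; exact: measurable_funX.
have m2 : measurable_fun [set: Omega] (fun w => (lin m (a m) (sample X w) ^+ 2)%:E).
  by apply/measurable_EFinP; exact: measurable_funX.
have m3 : measurable_fun [set: Omega] (fun w => (8 * lin m (a m) (sample X w) ^+ 2)%:E).
  by apply/measurable_EFinP; apply: measurable_funM => //; exact: measurable_funX.
have k0 := fourth_moment_ge0 (e 0).
have K0 : 0 <= K.
  by apply: mulr_ge0 => //; apply: mulr_ge0 => //; exact: sqr_ge0.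
rewrite ge0_integralD//; first last.
- exact: emeasurable_funD.
- by move=> w _; apply: adde_ge0; rewrite lee_fin ?sqr_ge0// mulr_ge0 ?sqr_ge0.
rewrite integral_probability_cst ge0_integralD//; first last.
- by move=> w _; rewrite lee_fin ?sqr_ge0 ?(mulr_ge0 _ (sqr_ge0 _)).
- by move=> w _; rewrite lee_fin ?sqr_ge0 ?(mulr_ge0 _ (sqr_ge0 _)).
have -> : (\int[P]_w (8 * lin m (a m) (sample X w) ^+ 2)%:E =
    8%:E * \int[P]_w (lin m (a m) (sample X w) ^+ 2)%:E)%E.
  rewrite -ge0_integralZl_EFin//.
  by move=> w _; rewrite lee_fin exprn_even_ge0.
apply: (@le_trans _ _ (((2 * k + 8) * \sum_(i < m) (a i i ^+ 2 + \sum_(l < i) a i l ^+ 2))%:E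
   + 8%:E * (\sum_(l < m) a m l ^+ 2)%:E + K%:E)%E).
  apply: leeD => //; apply: leeD => //.
  by apply: lee_wpmul2l; [rewrite lee_fin|exact: lin_second_moment].
rewrite -EFinM -!EFinD lee_fin big_ord_recr/= mulrDr -addrA lerD2l /K.
have s0 : 0 <= \sum_(l < m) a m l ^+ 2 by apply: sumr_ge0 => l _; rewrite exprn_even_ge0.
have a0 := exprn_even_ge0 (a m m) (isT : ~~ odd 2).
by have := mulr_ge0 k0 s0; have := mulr_ge0 k0 a0; nra.
Qed.

End quadratic_forms.

Section quadratic_form_matrix.
Context (R : realType).

Definition quad (n : nat) (M : 'M[R]_n) (v : 'cV[R]_n) : R :=
  (v^T *m M *m v) 0 0.

(** Indexing by natural numbers, as needed for an induction on the number of
    variables. *)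
Definition nat_entry (n : nat) (M : 'M[R]_n) (i l : nat) : R :=
  match insub i, insub l with
  | Some i', Some l' => M i' l'
  | _, _ => 0
  end.

Lemma nat_entry_ord n (M : 'M[R]_n) (i l : 'I_n) : nat_entry M i l = M i l.
Proof. by rewrite /nat_entry !valK. Qed.

Lemma nat_entry_sym n (M : 'M[R]_n) i l :
  M^T = M -> nat_entry M i l = nat_entry M l i.
Proof.
move=> Msym; rewrite /nat_entry; case: insubP => [u _ _|]; case: insubP => //= v _ _ .
by rewrite -[in LHS]Msym mxE.
Qed.

Lemma sum_sym_nat (f : nat -> nat -> R) n : (forall i l, f i l = f l i) ->
  \sum_(i < n) \sum_(l < n) f i l = \sum_(i < n) (f i i + 2 * \sum_(l < i) f i l).
Proof.
move=> fsym; elim: n => [|n IH]; first by rewrite !big_ord0.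
rewrite big_ord_recr [in RHS]big_ord_recr/=.
under eq_bigr do rewrite big_ord_recr/=.
rewrite big_split/= IH big_ord_recr/=.
under [X in _ + X + _ = _]eq_bigr do rewrite fsym.
by rewrite [RHS]addrA; ring.
Qed.

Lemma quadE n (M : 'M[R]_n) v :
  quad M v = \sum_i \sum_l v i 0 * M i l * v l 0.
Proof.
rewrite /quad mxE exchange_big/=; apply: eq_bigr => l _.
by rewrite mxE mulr_suml; apply: eq_bigr => i _; rewrite mxE.
Qed.

Context (I : choiceType).
Definition colv (n : nat) (e : nat -> I) (x : array R I) : 'cV[R]_n :=
  \col_(i < n) x (e i).

Lemma quad_chaos n (M : 'M[R]_n) (e : nat -> I) (x : array R I) : M^T = M ->
  quad M (colv n e x) - \tr M = chaos e n (nat_entry M) x.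
Proof.
move=> Msym.
have -> : quad M (colv n e x) =
    \sum_(i < n) \sum_(l < n) x (e i) * nat_entry M i l * x (e l).
  rewrite quadE; apply: eq_bigr => i _; apply: eq_bigr => l _.
  by rewrite nat_entry_ord !mxE.
rewrite (sum_sym_nat (f := fun i l => x (e i) * nat_entry M i l * x (e l))).
  rewrite /mxtrace /chaos -sumrB; apply: eq_bigr => i _.
  rewrite nat_entry_ord /lin mulrBr mulr1 expr2.
  rewrite -[in RHS]mulrA [x (e i) * \sum_(_ < _) _]mulr_sumr.
  under [in RHS]eq_bigr do rewrite mulrA.
  by ring.
by move=> i l; rewrite (nat_entry_sym i l Msym); ring.
Qed.

Context (dsp : measure_display) (Omega : measurableType dsp).
Context (P : probability Omega R) (X : I -> {RV P >-> R}).
Hypothesis indep : mutually_independent X.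
Variable k : R.
Hypothesis stdX : forall i, standardized P k (X i).

Lemma quad_variance n (M : 'M[R]_n) (e : nat -> I) : injective e -> M^T = M ->
  (\int[P]_w ((quad M (colv n e (sample X w)) - \tr M) ^+ 2)%:E <=
   ((2 * k + 8) * \sum_i \sum_l M i l ^+ 2)%:E)%E.
Proof.
move=> inj_e Msym.
under eq_integral do rewrite quad_chaos//.
apply: le_trans (chaos_second_moment indep stdX inj_e n (nat_entry M)) _.
rewrite lee_fin ler_wpM2l//.
  by have := fourth_moment_ge0 stdX (e 0); lra.
have -> : \sum_i \sum_l M i l ^+ 2 =
    \sum_(i < n) \sum_(l < n) nat_entry M i l ^+ 2.
  by apply: eq_bigr => i _; apply: eq_bigr => l _; rewrite nat_entry_ord.
rewrite (sum_sym_nat (f := fun i l => nat_entry M i l ^+ 2)); last first.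
  by move=> i l; rewrite (nat_entry_sym i l Msym).
apply: ler_sum => i _; rewrite lerD2l ler_peMl ?ler1n//.
by apply: sumr_ge0 => l _; exact: sqr_ge0.
Qed.

End quadratic_form_matrix.

(** * Probability of hitting a kernel *)

(** The vectors of the kernel are the combinations of the rows of a full-rank
    matrix; on a suitable set of columns this matrix is invertible. *)
Lemma kernel_determined (F : fieldType) n (M : 'M[F]_n) :
  exists (f : 'I_(n - \rank M) -> 'I_n) (N : 'M[F]_(n - \rank M, n)),
    injective f /\ forall v : 'rV[F]_n, v *m M = 0 -> v = colsub f v *m N.
Proof.
rewrite -mxrank_ker; set K := kermx M.
have fullB : row_full (row_base K)^T.
  by rewrite /row_full mxrank_tr eq_row_base.
pose f := fullrankfun fullB.
have Cunit : colsub f (row_base K) \in unitmx.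
  by rewrite -unitmx_tr -row_full_unit trmx_mxsub; exact: fullrowsub_full.
exists f, (invmx (colsub f (row_base K)) *m row_base K).
split; first exact: fullrankfun_inj.
move=> v /sub_kermxP; rewrite -/K -(eq_row_base K) => /submxP [y ->].
by rewrite -mulmx_colsub [RHS]mulmxA mulmxK.
Qed.

Section odlyzko.
Context (R : realType) (I : choiceType).
Context (dsp : measure_display) (Omega : measurableType dsp).
Context (P : probability Omega R) (X : I -> {RV P >-> R}).
Hypothesis indep : mutually_independent X.
Variable p : R.
Hypothesis atomX : forall i (c : R), (P (X i @^-1` [set c]) <= p%:E)%E.

Lemma atom_bound_ge0 (i : I) : 0 <= p.
Proof. by rewrite -lee_fin; apply: le_trans (atomX i 0). Qed.

Lemma product_of_atoms (J : {fset I}) (c : I -> R) :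
  (P (\bigcap_(i in [set` J]) X i @^-1` [set c i]) <= (p ^+ #|` J|)%:E)%E.
Proof.
rewrite (@indep J (fun i => [set c i]))//.
elim: (enum_fset J) => [|i s IH]; first by rewrite big_nil.
rewrite big_cons /= exprS EFinM; apply: lee_pmul => //.
by elim: {IH} s => [|j s IH]; rewrite ?big_nil// big_cons mule_ge0.
Qed.

(** Fix the coordinates that determine a vector of the kernel: each of the
    [\rank M] others has to take a prescribed value. *)
Lemma kernel_hit_bound n (M : 'M[R]_n) (e : nat -> I) : injective e ->
  (\int[P]_w (\1_[set x : array R I | (colv n e x)^T *m M = 0] (sample X w))%:E
    <= (p ^+ \rank M)%:E)%E.
Proof.
move=> inj_e.
have [f [N [inj_f det]]] := kernel_determined M.
pose c i (x : array R I) := (colsub f (colv n e x)^T *m N) 0 i.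
have mc i : measurable_fun [set: array R I] (c i).
  rewrite (_ : c i = fun x => \sum_l x (e (f l)) * N l i).
    apply: measurable_sum => l; apply: measurable_funM => //.
    exact: measurable_coord.
  by apply/funext => x; rewrite /c mxE; apply: eq_bigr => l _; rewrite !mxE.
pose A := [set t : array R I * array R I |
  forall i, i \notin codom f -> t.2 (e i) = c i t.1].
have mA : measurable A.
  have -> : A = \bigcap_(i in [set i | i \notin codom f])
      ((fun t : array R I * array R I => t.2 (e i) - c i t.1) @^-1` [set 0]).
    apply/seteqP; split => t /= H i /= /H; first by move=> ->; rewrite subrr.
    by move=> /eqP; rewrite subr_eq0 => /eqP.
  apply: fin_bigcap_measurable => [|i _]; first exact: finite_finset.
  rewrite -[X in measurable X]setTI.
  have mf : measurable_fun setT
      (fun t : array R I * array R I => t.2 (e i) - c i t.1).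
    apply: measurable_funB; last exact: (measurableT_comp (mc i)).
    by apply: (measurableT_comp (@measurable_coord R I (e i))).
  exact: mf.
pose H (x y : array R I) : \bar R := (\1_A (x, y))%:E.
have mH : measurable_fun [set: array R I * array R I] (fun t => H t.1 t.2).
  apply/measurable_EFinP; rewrite (_ : (fun _ => _) = \1_A).
    exact: measurable_indic.
  by apply/funext => -[].
have mS : measurable_fun [set: Omega] (sample X) by exact: measurable_sample.
have mHs : measurable_fun [set: array R I] (fun x => H x x).
  exact: (measurableT_comp mH (measurable_fun_pair (@measurable_id _ _ _) (@measurable_id _ _ _))).
have mK : measurable_fun [set: array R I]
    (fun x => (\1_[set x : array R I | (colv n e x)^T *m M = 0] x : R)%:E).
  apply/measurable_EFinP/measurable_indic.
  rewrite (_ : [set _ | _] = \bigcap_(i in [set: 'I_n])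
      ((fun x : array R I => ((colv n e x)^T *m M) 0 i) @^-1` [set 0])).
    apply: fin_bigcap_measurable => // i _.
    rewrite -[X in measurable X]setTI.
    have mf : measurable_fun [set: array R I] (fun x => ((colv n e x)^T *m M) 0 i).
      rewrite (_ : (fun _ => _) = fun x => \sum_(l < n) x (e l) * M l i).
        apply: measurable_sum => l; apply: measurable_funM => //.
        exact: measurable_coord.
      by apply/funext => x; rewrite mxE; apply: eq_bigr => l _; rewrite !mxE.
    exact: mf.
  apply/seteqP; split => x /=.
    by move=> Hx i _; rewrite /preimage/= Hx mxE.
  by move=> Hx; apply/rowP => i; rewrite (Hx i)// mxE.
pose S i := [exists l : 'I_(n - \rank M), i == e (f l)].
apply: (@le_trans _ _ (\int[P]_w H (sample X w) (sample X w))%E).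
  apply: integral_le_mono.
  - by move=> w; rewrite lee_fin.
  - exact: (measurableT_comp mK mS).
  - exact: (measurableT_comp mHs mS).
  - move=> w; rewrite lee_fin /H !indicE ler_nat.
    case: (boolP (sample X w \in [set x : array R I | (colv n e x)^T *m M = 0])) => //.
    move=> /set_mem/= ker; rewrite mem_set// => i _ /=; rewrite /c -det//.
    by rewrite !mxE.
rewrite (decouple indep (S := S))//; first last.
- move=> x x' y y' Sx Sy; rewrite /H !indicE; congr (nat_of_bool _)%:R%:E.
  have cx i : c i x = c i x'.
    rewrite /c; congr ((_ *m _) 0 i); apply/rowP => l; rewrite !mxE Sx//.
    by apply/existsP; exists l.
  have yS i : i \notin codom f -> y (e i) = y' (e i).
    move=> /negP fi; apply: Sy; apply/negP => /existsP[l /eqP /inj_e /val_inj il].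
    by apply: fi; rewrite il codom_f.
  apply/idP/idP => /set_mem Ht; apply/mem_set => i fi /=.
    by rewrite -cx -yS//; exact: Ht.
  by rewrite cx yS//; exact: Ht.
- by move=> x y; rewrite lee_fin.
apply: (@le_trans _ _ (\int[P]_w (p ^+ \rank M)%:E)%E); last first.
  by rewrite integral_probability_cst.
apply: integral_le_mono => //.
- by move=> w; apply: integral_ge0 => w' _; rewrite lee_fin.
- apply: (measurable_fun_fubini_tonelli_F
      (fun z : Omega * Omega => H (sample X z.1) (sample X z.2))) => //.
  + exact: (measurableT_comp mH (measurable_fun_pair
      (measurableT_comp mS measurable_fst) (measurableT_comp mS measurable_snd))).
  + by move=> z; rewrite lee_fin.
move=> w.
pose J : {fset I} := seq_fset tt [seq e (val i) | i <- enum [pred i | i \notin codom f]].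
have cardJ : #|` J| = \rank M.
  rewrite size_seq_fset undup_id; last first.
    rewrite map_inj_uniq ?enum_uniq//.
    by move=> i j /inj_e /val_inj.
  rewrite size_map -cardE.
  have := cardC (mem (codom f)); rewrite card_ord card_codom// card_ord.
  have -> : #|[predC (mem (codom f))]| = #|[pred i | i \notin codom f]| by exact: eq_card.
  by move=> Hc; have := rank_leq_row M; lia.
pose d (i : I) : R := if pselect (exists2 j : 'I_n, j \notin codom f & i = e j) is left ex
   then c (projT1 (cid2 ex)) (sample X w) else 0.
have dE (j : 'I_n) : j \notin codom f -> d (e j) = c j (sample X w).
  move=> fj; rewrite /d; case: pselect => [ex|[]]; last by exists j.
  by case: cid2 => j' /= _ /inj_e /val_inj ->.
rewrite -cardJ; apply: le_trans (product_of_atoms J d).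
rewrite (_ : (\int[P]_w' H (sample X w) (sample X w'))%E =
  P (\bigcap_(i in [set` J]) X i @^-1` [set d i]))//.
have mJ : measurable (\bigcap_(i in [set` J]) X i @^-1` [set d i]).
  apply: fin_bigcap_measurable => [|i _]; first exact: finite_fset.
  rewrite -[X in _ X]setTI; exact: (@measurable_funPT _ _ _ _ (X i)) => //.
rewrite -(setIT (\bigcap_(i in _) _)) -integral_indic//.
apply: eq_integral => w' _; rewrite /H !indicE; congr (nat_of_bool _)%:R%:E.
apply/idP/idP => /set_mem Ht; apply/mem_set.
  move=> i /=; rewrite seq_fsetE => /mapP[j]; rewrite mem_enum inE => fj ->.
  by rewrite dE//; exact: Ht.
move=> i fi /=; rewrite -dE//; apply: Ht => /=.
by rewrite seq_fsetE map_f// mem_enum.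
Qed.

End odlyzko.

(** * Random columns *)

Section random_columns.
Context (R : realType) (dsp : measure_display) (Omega : measurableType dsp).
Context (P : probability Omega R) (X : nat * nat -> {RV P >-> R}).
Hypothesis indep : mutually_independent X.
Variable k : R.
Hypothesis stdX : forall ij, standardized P k (X ij).
Variable n : nat.

Definition column (j : nat) (x : array R (nat * nat)%type) : 'cV[R]_n :=
  colv n (fun i => (i, j)) x.

Definition columns (js : seq nat) (x : array R (nat * nat)%type) : seq 'cV[R]_n :=
  [seq column j x | j <- js].

Let inj_row (j : nat) : injective (fun i : nat => (i, j)).
Proof. by move=> i i' []. Qed.

Lemma measurable_column d (T : measurableType d) (f : T -> array R (nat * nat)%type) j :
  measurable_fun [set: T] f -> measurable_mx (fun t => column j (f t)).
Proof.
move=> mf i l; rewrite (_ : (fun _ => _) = fun t => f t (val i, j)).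
  exact: (measurableT_comp (@measurable_coord R _ (val i, j)) mf).
by apply/funext => t; rewrite mxE.
Qed.

Lemma eq_columns (S : pred (nat * nat)) js (x y : array R (nat * nat)%type) :
  (forall i j, j \in js -> S (i, j)) -> (forall ij, S ij -> x ij = y ij) ->
  columns js x = columns js y.
Proof.
move=> Sjs xy; apply/eq_in_map => j js_j; apply/colP => i.
by rewrite !mxE xy// Sjs.
Qed.

Let k0 : 0 <= k := fourth_moment_ge0 stdX (0, 0)%N.

Section contraction.
Variables (c D beta tau : R).
Hypotheses (c0 : 0 <= c) (beta0 : 0 <= beta) (tau0 : 0 < tau).
Hypothesis gap : beta + tau <= n%:R - D.

(** The first term is the value at [beta]; the second is the variance bound
    divided by the square of the distance [tau] from [beta] to the mean. *)
Definition contraction_rate : R :=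
  (Num.sqrt (1 + c * beta))^-1 + (2 * k + 8) * n%:R / tau ^+ 2.

(** Chebyshev's inequality before integration: below [beta] the last term is
    already at least one. *)
Lemma contraction_pointwise (q T : R) : 0 <= q -> beta + tau <= T ->
  (Num.sqrt (1 + c * q))^-1 <=
  (Num.sqrt (1 + c * beta))^-1 + tau ^- 2 * (q - T) ^+ 2.
Proof.
move=> q0 Tb; have cb : 0 <= c * beta by rewrite mulr_ge0.
have cq : 0 <= c * q by rewrite mulr_ge0.
have [bq|qb] := lerP beta q.
  rewrite -[leLHS]addr0; apply: lerD; last first.
    by apply: mulr_ge0; rewrite ?sqr_ge0// invr_ge0 exprn_ge0// ltW.
  have sq0 x : 0 <= x -> 0 < Num.sqrt (1 + x) by move=> x0; rewrite sqrtr_gt0; lra.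
  rewrite lef_pV2 ?posrE ?sq0//.
  by rewrite ler_wsqrtr// lerD2l ler_wpM2l.
have : 1 <= tau ^- 2 * (q - T) ^+ 2.
  rewrite mulrC ler_pdivlMr ?exprn_gt0// mul1r -[leRHS]sqrrN opprB.
  have t0 := tau0; have tq : tau <= T - q by lra.
  by apply: lerXn2r => //; rewrite nnegrE; lra.
have : 0 <= (Num.sqrt (1 + c * beta))^-1 by rewrite invr_ge0 sqrtr_ge0.
suff : (Num.sqrt (1 + c * q))^-1 <= 1 by lra.
rewrite invf_le1 ?sqrtr_gt0; last by lra.
rewrite -[leLHS]sqrtr1; apply: ler_wsqrtr; lra.
Qed.

Lemma expected_contraction (M : 'M[R]_n) j : orthoproj M ->
  n%:R - D <= \tr M -> \tr M <= n%:R ->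
  (\int[P]_w ((Num.sqrt (1 + c * sqnorm (M *m column j (sample X w))))^-1)%:E
    <= contraction_rate%:E)%E.
Proof.
move=> pM trM1 trM2; have [Ms Mi] := pM.
have mS : measurable_fun [set: Omega] (sample X) by exact: measurable_sample.
have mq : measurable_fun [set: Omega] (fun w => sqnorm (M *m column j (sample X w))).
  apply: measurable_sqnorm; apply: measurable_mxM; first exact: measurable_mx_cst.
  exact: measurable_column.
pose q w := sqnorm (M *m column j (sample X w)).
have m2 : measurable_fun [set: Omega] (fun w => (q w - \tr M) ^+ 2).
  by apply: measurable_funX; exact: measurable_funB.
apply: (@le_trans _ _ (\int[P]_w (((Num.sqrt (1 + c * beta))^-1)%:E +
    (tau ^- 2)%:E * ((q w - \tr M) ^+ 2)%:E))%E).
  apply: integral_le_mono.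
  - by move=> w; rewrite lee_fin invr_ge0 sqrtr_ge0.
  - by apply/measurable_EFinP; exact: measurable_contraction.
  - apply: emeasurable_funD => //; apply: measurable_funeM.
    exact/measurable_EFinP.
  - move=> w; rewrite -EFinM -EFinD lee_fin; apply: contraction_pointwise.
      exact: sqnorm_ge0.
    exact: le_trans gap trM1.
rewrite ge0_integralD//; first last.
- by apply: measurable_funeM; exact/measurable_EFinP.
- by move=> w _; rewrite mule_ge0// lee_fin ?sqr_ge0 ?invr_ge0 ?exprn_ge0 ?(ltW tau0).
rewrite integral_probability_cst ge0_integralZl_EFin//; first last.
- by rewrite invr_ge0 exprn_ge0// ltW.
- exact/measurable_EFinP.
- by move=> w _; rewrite lee_fin sqr_ge0.
rewrite /contraction_rate EFinD leeD2l//.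
rewrite mulrC EFinM; apply: lee_wpmul2l.
  by rewrite lee_fin invr_ge0 exprn_ge0// ltW.
have := quad_variance indep stdX (@inj_row j) Ms.
rewrite orthoproj_frobenius// => H.
apply: (@le_trans _ _ ((2 * k + 8) * \tr M)%:E).
  apply: le_trans H; rewrite le_eqVlt; apply/orP; left; apply/eqP.
  by apply: eq_integral => w _; rewrite /q orthoproj_quad.
by rewrite lee_fin ler_wpM2l//; have := k0; lra.
Qed.

Lemma contraction_rate_ge0 : 0 <= contraction_rate.
Proof.
have k1 := k0; rewrite /contraction_rate addr_ge0 ?invr_ge0 ?sqrtr_ge0//.
rewrite divr_ge0 ?exprn_ge0 ?(ltW tau0)// mulr_ge0//; lra.
Qed.
End contraction.

(** Given the other columns, the first one contributes a factor of conditional mean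
    at most [contraction_rate]: the projection involved has trace at least
    [n - D]. *)
Lemma expected_volume_factor (h a D beta tau : R) js :
  0 <= h * a -> 0 <= beta -> 0 < tau -> beta + tau <= n%:R - D ->
  uniq js -> (size js)%:R <= D ->
  (\int[P]_w (volume_factor h a (columns js (sample X w)))%:E <=
   (contraction_rate (h * a) beta tau ^+ size js)%:E)%E.
Proof.
move=> ha0 beta0 tau0 gap; elim: js => [_ _|j js IH].
  by under eq_integral do rewrite /=; rewrite integral_probability_cst.
rewrite /= => /andP[jjs ujs] sD.
have sD' : (size js)%:R <= D by apply: le_trans sD; rewrite ler_nat.
pose S (ij : nat * nat) := ij.2 != j.
have Sjs i j' : j' \in js -> S (i, j').
  by move=> j'js; rewrite /S /=; apply: contraNneq jjs => <-.
pose H (x y : array R (nat * nat)%type) : \bar R :=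
  ((Num.sqrt (1 + h * (a * residual (columns js x) (column j y))))^-1 *
   volume_factor h a (columns js x))%:E.
have H0 x y : (0 <= H x y)%E.
  by rewrite lee_fin mulr_ge0 ?volume_factor_ge0 ?invr_ge0 ?sqrtr_ge0.
have mH d (T : measurableType d) (f g : T -> array R (nat * nat)%type) :
    measurable_fun [set: T] f -> measurable_fun [set: T] g ->
    measurable_fun [set: T] (fun t => H (f t) (g t)).
  move=> mf mg; apply/measurable_EFinP; apply: measurable_funM.
    apply: measurable_contraction; apply: measurable_funM => //.
    apply: measurable_residual; last exact: measurable_column.
    by move=> j'; exact: measurable_column.
  apply: measurable_volume_factor.
  by move=> j'; exact: measurable_column.
have mS : measurable_fun [set: Omega] (sample X) by exact: measurable_sample.
rewrite (_ : (fun w => _) = fun w => H (sample X w) (sample X w))//.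
rewrite (decouple indep (S := S))//; first last.
- move=> x x' y y' Sx Sy; rewrite /H (eq_columns Sjs Sx).
  congr (((Num.sqrt (1 + h * (a * residual _ _)))^-1 * _)%:E).
  by apply/colP => i; rewrite !mxE Sy// /S /= eqxx.
- by apply: mH; exact: measurable_id.
set rho := contraction_rate (h * a) beta tau.
have rho0 : 0 <= rho by exact: contraction_rate_ge0.
have mV : measurable_fun [set: Omega]
    (fun w => (volume_factor h a (columns js (sample X w)))%:E).
  apply/measurable_EFinP; apply: measurable_volume_factor.
  by move=> j'; exact: measurable_column.
apply: (@le_trans _ _ (\int[P]_w (rho%:E *
    (volume_factor h a (columns js (sample X w)))%:E))%E).
  apply: integral_le_mono => [w|||w].
  - by apply: integral_ge0.
  - apply: (measurable_fun_fubini_tonelli_F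
      (fun z : Omega * Omega => H (sample X z.1) (sample X z.2))) => //.
    by apply: mH; exact: (measurableT_comp mS).
  - exact: measurable_funeM.
  - rewrite /H; under eq_integral do rewrite mulrC EFinM.
    rewrite ge0_integralZl_EFin ?volume_factor_ge0//; last first.
      apply/measurable_EFinP; apply: measurable_contraction.
      apply: measurable_funM => //; apply: measurable_sqnorm.
      apply: measurable_mxM; first exact: measurable_mx_cst.
      exact: measurable_column.
    rewrite [leRHS]muleC; apply: lee_wpmul2l; first by rewrite lee_fin volume_factor_ge0.
    have /andP[t1 t2] := mxtrace_residual (columns js (sample X w)).
    apply: le_trans (expected_contraction ha0 beta0 tau0 gap j
      (orthoproj_residual (columns js (sample X w))) _ t2).
      rewrite le_eqVlt; apply/orP; left; apply/eqP; apply: eq_integral => w' _.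
      by rewrite mulrA.
    by apply: le_trans t1; rewrite size_map; lra.
rewrite ge0_integralZl_EFin//; last by move=> w _; rewrite lee_fin volume_factor_ge0.
by rewrite exprS EFinM; apply: lee_wpmul2l => //; exact: IH.
Qed.

Section rank.
Variable p : R.
Hypothesis p1 : p <= 1.
Hypothesis atomX : forall ij (c : R), (P (X ij @^-1` [set c]) <= p%:E)%E.

(** Given the columns [js], the residual vanishes when the column [j] hits the
    kernel of a matrix of rank at least [n - size js]. *)
Lemma degenerate_column j js : j \notin js ->
  (P [set w | residual (columns js (sample X w)) (column j (sample X w)) = 0%R]
   <= (p ^+ (n - size js))%:E)%E.
Proof.
move=> jjs.
have p0 : 0 <= p by exact: (atom_bound_ge0 atomX (0, 0)%N).
pose S (ij : nat * nat) := ij.2 != j.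
have Sjs i j' : j' \in js -> S (i, j').
  by move=> j'js; rewrite /S /=; apply: contraNneq jjs => <-.
pose A := [set t : array R (nat * nat)%type * array R (nat * nat)%type |
  residual (columns js t.1) (column j t.2) = 0].
have mA : measurable A.
  have mr : measurable_fun setT
      (fun t : array R (nat * nat)%type * array R (nat * nat)%type =>
        residual (columns js t.1) (column j t.2)).
    apply: measurable_residual; last exact: measurable_column.
    by move=> j'; exact: measurable_column.
  have -> : A = (fun t => residual (columns js t.1) (column j t.2)) @^-1` [set 0] by [].
  by rewrite -[X in measurable X]setTI; exact: mr.
pose H (x y : array R (nat * nat)%type) : \bar R := (\1_A (x, y))%:E.
have H0 x y : (0 <= H x y)%E by rewrite lee_fin.
have mH d (T : measurableType d) (f g : T -> array R (nat * nat)%type) :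
    measurable_fun [set: T] f -> measurable_fun [set: T] g ->
    measurable_fun [set: T] (fun t => H (f t) (g t)).
  move=> mf mg; apply/measurable_EFinP.
  exact: (measurableT_comp (@measurable_indic _ _ R setT A mA) (measurable_fun_pair mf mg)).
have mS : measurable_fun [set: Omega] (sample X) by exact: measurable_sample.
have -> : P [set w | residual (columns js (sample X w)) (column j (sample X w)) = 0%R] =
    (\int[P]_w H (sample X w) (sample X w))%E.
  have mB : measurable [set w | residual (columns js (sample X w)) (column j (sample X w)) = 0%R].
    have := measurable_fun_pair mS mS; move/(_ measurableT A mA); rewrite setTI.
    by apply.
  by rewrite -[X in P X]setIT -integral_indic.
rewrite (decouple indep (S := S))//; first last.
- move=> x x' y y' Sx Sy; rewrite /H !indicE; congr (nat_of_bool _)%:R%:E.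
  have cy : column j y = column j y'.
    by apply/colP => i; rewrite !mxE Sy// /S /= eqxx.
  have cx := eq_columns Sjs Sx.
  by apply/idP/idP => /set_mem Ht; apply/mem_set; move: Ht; rewrite /A/= cx cy.
- by apply: mH; exact: measurable_id.
apply: (@le_trans _ _ (\int[P]_w (p ^+ (n - size js))%:E)%E); last first.
  by rewrite integral_probability_cst.
apply: integral_le_mono => // [w||w].
- exact: integral_ge0.
- apply: (measurable_fun_fubini_tonelli_F
    (fun z : Omega * Omega => H (sample X z.1) (sample X z.2))) => //.
  by apply: mH; exact: (measurableT_comp mS).
set M := residual_proj (columns js (sample X w)).
have [Ms Mi] : orthoproj M := orthoproj_residual _.
apply: le_trans (le_trans (kernel_hit_bound indep atomX M (@inj_row j)) _).
  rewrite le_eqVlt; apply/orP; left; apply/eqP; apply: eq_integral => w' _.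
  rewrite /H !indicE; congr (nat_of_bool _)%:R%:E.
  apply/idP/idP => /set_mem Ht; apply/mem_set; move: Ht; rewrite /A /=.
    move=> /eqP; rewrite sqnorm_eq0 => /eqP Mc.
    by rewrite -Ms -trmx_mul -/(column j (sample X w')) Mc trmx0.
  rewrite -[in X in X -> _]Ms -trmx_mul => /(congr1 trmx); rewrite trmxK trmx0 => Mc.
  by apply/eqP; rewrite sqnorm_eq0; apply/eqP.
rewrite lee_fin ler_wiXn2l//.
by have := mxrank_residual (columns js (sample X w)); rewrite size_map leq_subLR addnC.
Qed.
End rank.
End random_columns.

(** * Moments and atoms of the common law *)

Section atoms.
Context (R : realType) (dsp : measure_display) (Omega : measurableType dsp).
Context (P : probability Omega R).

Lemma standardized_of_moments (k : R) (Z : {RV P >-> R}) :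
  ('E_P[Z] = 0)%E -> ('V_P[Z] = 1)%E -> ('E_P[(fun w => Z w ^+ 4)%R] <= k%:E)%E ->
  standardized P k Z.
Proof.
move=> Z1; rewrite /variance unlock Z1 /= => Z2 Z4; split.
- exact: measurable_funPT.
- by move: Z1; rewrite unlock.
- rewrite -Z2 unlock; apply: eq_integral => w _; congr EFin.
  by rewrite -[RHS]/((Z w - 0) * (Z w - 0)) subr0 expr2.
- by move: Z4; rewrite unlock.
Qed.

(** A constant variable of mean zero has a zero second moment. *)
Lemma standardized_atom_lt1 (k : R) (Z : {RV P >-> R}) (c : R) :
  standardized P k Z -> (P (Z @^-1` [set c]) < 1)%E.
Proof.
move=> [mZ Z1 Z2 _].
have mA : measurable (Z @^-1` [set c]).
  by rewrite -[X in measurable X]setTI; exact: mZ.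
rewrite lt_neqAle probability_le1// andbT; apply/eqP => Pc.
have Zc : ae_eq P setT (EFin \o Z) (cst c%:E).
  exists (~` (Z @^-1` [set c])); split; first exact: measurableC.
    by rewrite [LHS](probability_setC P mA) Pc subee.
  by move=> w /= Zw Zwc; apply: Zw => _; rewrite Zwc.
have Z2c : ae_eq P setT (EFin \o (fun w => Z w ^+ 2)) (cst (c ^+ 2)%:E).
  by apply: filterS Zc => w /= /[apply] -[->].
have c1 : c = 0.
  apply/eqP; rewrite -eqe -[X in _ == X]Z1 -(integral_probability_cst P c).
  apply/eqP/esym; apply: ae_eq_integral => //; exact/measurable_EFinP.
have : (c ^+ 2)%:E = 1%:E :> \bar R.
  rewrite -[RHS]Z2 -(integral_probability_cst P (c ^+ 2)).
  apply/esym; apply: ae_eq_integral => //.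
  by apply/measurable_EFinP; exact: measurable_funX.
by rewrite c1 expr0n /= => /eqP; rewrite eqe eq_sym oner_eq0.
Qed.

(** At most one atom exceeds one half. *)
Lemma atoms_bounded (k : R) (Z : {RV P >-> R}) : standardized P k Z ->
  exists p : R, [/\ 0 < p, p < 1 & forall c, (P (Z @^-1` [set c]) <= p%:E)%E].
Proof.
move=> stdZ.
have mA c : measurable (Z @^-1` [set c]).
  by rewrite -[X in measurable X]setTI; exact: (std_measurable stdZ).
have finA c : P (Z @^-1` [set c]) \is a fin_num by exact: fin_num_measure.
have [[c0 c0P]|noatom] := pselect (exists c, ((2^-1)%:E < P (Z @^-1` [set c]))%E); last first.
  exists 2^-1; split; [by rewrite invr_gt0|by rewrite invf_lt1// ltr1n|].
  by move=> c; rewrite leNgt; apply/negP => h; apply: noatom; exists c.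
exists (fine (P (Z @^-1` [set c0]))); split.
- rewrite fine_gt0// (lt_trans _ c0P) ?lte_fin ?invr_gt0//=.
  by rewrite -ge0_fin_numE.
- by rewrite -lte_fin fineK//; exact: standardized_atom_lt1 stdZ.
move=> c; rewrite fineK//; have [->//|cc0] := eqVneq c c0.
have disj : [disjoint (Z @^-1` [set c]) & (Z @^-1` [set c0])].
  apply/disj_setPS => w [/= -> ] /eqP; by rewrite (negbTE cc0).
have : (P (Z @^-1` [set c]) + P (Z @^-1` [set c0]) <= 1)%E.
  rewrite -measureU//; last by apply/eqP; rewrite -disj_set2E.
  by apply: probability_le1; exact: measurableU.
move: c0P; rewrite -(fineK (finA c)) -(fineK (finA c0)) -EFinD !lee_fin lte_fin.
lra.
Qed.

End atoms.

(** * Exponentially small events and asymptotic constants *)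

Section borel_cantelli_geometric.
Context (R : realType) (dsp : measure_display) (Omega : measurableType dsp).
Context (P : probability Omega R).

Lemma sum_geometric_le (r : R) n : 0 <= r -> r < 1 ->
  \sum_(i < n) r ^+ i <= (1 - r)^-1.
Proof.
move=> r0 r1; rewrite -[leRHS]mul1r ler_pdivlMr ?subr_gt0//.
rewrite mulrC -opprB mulNr -subrX1 opprB lerBlDr lerDl.
exact: exprn_ge0.
Qed.

Lemma ae_eventually_notin (E : nat -> set Omega) (C r : R) :
  (forall n, measurable (E n)) -> 0 <= C -> 0 <= r -> r < 1 ->
  (forall n, P (E n) <= (C * r ^+ n)%:E)%E ->
  {ae P, forall w, \forall n \near \oo, ~ E n w}.
Proof.
move=> mE C0 r0 r1 PE.
have : P (lim_sup_set E) = 0%E.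
  apply: lim_sup_set_cvg0 => //.
  apply: (@le_lt_trans _ _ (C * (1 - r)^-1)%:E); last by rewrite ltry.
  apply: lime_le; first exact: is_cvg_nneseries.
  near=> n; rewrite big_mkord.
  apply: (@le_trans _ _ (\sum_(i < n) (C * r ^+ i)%:E)%E); first by apply: lee_sum => i _; exact: PE.
  rewrite sumEFin lee_fin -mulr_sumr; apply: ler_wpM2l => //.
  exact: sum_geometric_le.
move=> Plim; exists (lim_sup_set E); split => //.
  apply: bigcap_measurable => // n _; apply: bigcup_measurable => j _; exact: mE.
move=> w nw; rewrite /lim_sup_set => n _.
apply: contrapT => Hn; apply: nw.
exists n => // j /= nj Ej; apply: Hn; by exists j.
Unshelve. all: by end_near. Qed.

End borel_cantelli_geometric.

Section numeric.
Context (R : realType).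

(** As [n] grows, the ratio of the square roots of [1 + x / 2] and of [1 + x] with
    [x = c b n] gets close to the square root of one half, below 3 / 4, and the
    variance term is of order the inverse square root of [n], below 1 / 8. *)
Lemma contraction_rate_small (k c b e : R) : 0 <= k -> 0 < c -> 0 < b -> 0 < e ->
  \forall n \near \oo,
    Num.sqrt (1 + c * n%:R * b / 2) * contraction_rate k n c (b * n%:R) (e * n%:R)
      <= 7 / 8.
Proof.
move=> k0 c0 b0 e0.
have cb0 : 0 < c * b by rewrite mulr_gt0.
pose K := (2 * k + 8) / e ^+ 2.
have K0 : 0 < K by rewrite divr_gt0 ?exprn_gt0//; lra.
have : \forall n \near \oo, (7 / (c * b) + 64 * K ^+ 2 * (c * b)) <= n%:R :> R.
  exact: nbhs_infty_ger.
apply: filterS => n nbig.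
have n1 : 7 / (c * b) <= n%:R.
  apply: le_trans nbig; rewrite lerDl; apply: mulr_ge0; last exact: ltW.
  by apply: mulr_ge0 => //; exact: sqr_ge0.
have n2 : 64 * K ^+ 2 * (c * b) <= n%:R.
  by apply: le_trans nbig; rewrite lerDr divr_ge0// ltW.
have n0 : 0 < n%:R :> R by apply: lt_le_trans n1; rewrite divr_gt0.
have {}n1 : 7 <= c * b * n%:R by rewrite ler_pdivrMr// in n1; lra.
set x := c * b * n%:R in n1.
have -> : c * n%:R * b / 2 = x / 2 by rewrite /x; ring.
rewrite /contraction_rate mulrDr.
have -> : c * (b * n%:R) = x by rewrite /x mulrA.
have -> : (2 * k + 8) * n%:R / (e * n%:R) ^+ 2 = K / n%:R.
  by rewrite /K; field; rewrite !gt_eqF.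
clearbody K.
have h1 : Num.sqrt (1 + x / 2) / Num.sqrt (1 + x) <= 3 / 4.
  have S0 : 0 < 1 + x by lra.
  rewrite ler_pdivrMr ?sqrtr_gt0//.
  have -> : 3 / 4 = Num.sqrt (9 / 16) :> R.
    have -> : 9 / 16 = (3 / 4) ^+ 2 :> R by field.
    by rewrite sqrtr_sqr ger0_norm//; lra.
  rewrite -sqrtrM; last lra.
  by apply: ler_wsqrtr; lra.
have h2 : Num.sqrt (1 + x / 2) * (K / n%:R) <= 1 / 8.
  rewrite mulrA ler_pdivrMr// -ler_pdivlMr//.
  have y0 : 0 <= 1 / 8 * n%:R / K by rewrite !mulr_ge0 ?invr_ge0 ?ler0n// ltW.
  rewrite -[leRHS]ger0_norm// -sqrtr_sqr; apply: ler_wsqrtr.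
  have -> : (1 / 8 * n%:R / K) ^+ 2 = n%:R ^+ 2 / (64 * K ^+ 2).
    by field; rewrite gt_eqF.
  rewrite ler_pdivlMr ?mulr_gt0 ?exprn_gt0//.
  apply: (@le_trans _ _ (x * (64 * K ^+ 2))).
    apply: ler_wpM2r; last lra.
    by apply: mulr_ge0 => //; exact: sqr_ge0.
  rewrite /x expr2 [leLHS](_ : _ = 64 * K ^+ 2 * (c * b) * n%:R); last by ring.
  by rewrite ler_wpM2r// ltW.
lra.
Qed.

Lemma powR_sqrt_expn (x : R) d : 0 < x ->
  x `^ (- (d%:R / 2)) = ((Num.sqrt x)^-1) ^+ d.
Proof.
move=> x0; rewrite powRN exprVn; congr (_^-1).
rewrite -powR12_sqrt ?ltW// -powR_mulrn ?powR_ge0// -powRrM; congr (_ `^ _).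
by rewrite mulrC.
Qed.

Lemma expn_le_geometric (q a : R) d n : 0 < q -> q <= 1 -> 
  a * n%:R <= d%:R -> q ^+ d <= (q `^ a) ^+ n.
Proof.
move=> q0 q1 ad; rewrite -powR_mulrn ?(ltW q0)// -powR_mulrn ?powR_ge0// -powRrM.
by rewrite /powR gt_eqF// ler_expR ler_wnM2r// -ln1 ler_ln ?posrE.
Qed.

End numeric.

(** * The two exceptional events *)

Section bad_events.
Context (R : realType) (dsp : measure_display) (Omega : measurableType dsp).
Context (P : probability Omega R) (X : nat * nat -> {RV P >-> R}).
Hypothesis indep : mutually_independent X.
Variables (k p : R).
Hypothesis stdX : forall ij, standardized P k (X ij).
Hypotheses (p0 : 0 <= p) (p1 : p < 1).
Hypothesis atomX : forall ij (c : R), (P (X ij @^-1` [set c]) <= p%:E)%E.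
Variables n d : nat.

Lemma regular_columns m l (x : array R (nat * nat)%type) :
  (forall j, (m <= j < m + l)%N ->
     residual (columns n (iota j.+1 (m + l - j.+1)) x) (column n j x) != 0) ->
  regular (columns n (iota m l) x).
Proof.
elim: l m => //= l IH m H; apply/andP; split.
  by have := H m; rewrite leqnn addnS ltnS leq_addr subSS addKn; apply.
apply: IH => j /andP[mj jl]; have := H j; rewrite addSnnS; apply.
by rewrite ltnW//= -addSnnS.
Qed.

Let mS : measurable_fun [set: Omega] (sample X). Proof. exact: measurable_sample. Qed.

(** The column [j] lies in the span of the columns from [j + 1] to [d - 1]. *)
Definition rank_event (j : nat) : set Omega :=
  [set w | residual (columns n (iota j.+1 (d - j.+1)) (sample X w))
     (column n j (sample X w)) = 0].

Definition rank_deficiency : set Omega := \big[setU/set0]_(j < d) rank_event j.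

Lemma measurable_rank_event j : measurable (rank_event j).
Proof.
have mr : measurable_fun [set: Omega] (fun w =>
    residual (columns n (iota j.+1 (d - j.+1)) (sample X w)) (column n j (sample X w))).
  apply: measurable_residual; last exact: measurable_column.
  by move=> j'; exact: measurable_column.
by rewrite -[rank_event j]setTI; exact: (mr measurableT [set 0]).
Qed.

Lemma measurable_rank_deficiency : measurable rank_deficiency.
Proof. by apply: bigsetU_measurable => j _; exact: measurable_rank_event. Qed.

(** The probabilities of the events form a geometric progression, as the number of
    columns to avoid grows. *)
Lemma rank_deficiency_bound : (d <= n)%N ->
  (P rank_deficiency <= ((1 - p)^-1 * p ^+ (n - d))%:E)%E.
Proof.
move=> dn; apply: (le_trans (Boole_inequality P _)).
  by move=> j _; exact: measurable_rank_event.
apply: (@le_trans _ _ (\sum_(j < d) (p ^+ (n - d) * p ^+ j)%:E)%E).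
  apply: lee_sum => j _.
  have jn : val j \notin iota j.+1 (d - j.+1) by rewrite mem_iota ltnn.
  apply: le_trans (degenerate_column indep n (ltW p1) atomX jn) _.
  rewrite size_iota lee_fin -exprD ler_wiXn2l// ?ltW//.
  have jd := ltn_ord j; lia.
rewrite sumEFin lee_fin -mulr_sumr mulrC ler_wpM2r ?exprn_ge0//.
exact: sum_geometric_le.
Qed.

Lemma regular_off_rank_deficiency w : ~ rank_deficiency w ->
  regular (columns n (iota 0 d) (sample X w)).
Proof.
move=> bad; apply: regular_columns => j; rewrite add0n => /andP[_ jd].
apply/eqP => res0; apply: bad; rewrite /rank_deficiency -bigcup_mkord.
by exists j.
Qed.

Variables (h a : R).

Definition volume w : R := volume_factor h a (columns n (iota 0 d) (sample X w)).

Lemma measurable_volume : measurable_fun [set: Omega] volume.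
Proof.
apply: measurable_volume_factor => j; exact: measurable_column.
Qed.

Definition volume_excess (t : R) : set Omega := [set w | t < volume w].

Lemma measurable_volume_excess t : measurable (volume_excess t).
Proof.
rewrite (_ : volume_excess t = volume @^-1` `]t, +oo[%classic).
  by rewrite -[X in measurable X]setTI; exact: measurable_volume.
by apply/seteqP; split => w /=; rewrite in_itv/= andbT.
Qed.

(** Markov's inequality. *)
Lemma volume_excess_bound (t beta tau : R) : 0 < t -> 0 <= h * a ->
  0 <= beta -> 0 < tau -> beta + tau <= n%:R - d%:R ->
  (P (volume_excess t) <=
   (t^-1 * contraction_rate k n (h * a) beta tau ^+ d)%:E)%E.
Proof.
move=> t0 ha0 beta0 tau0 gap.
have mE := measurable_volume_excess t.
rewrite -[X in P X]setIT -integral_indic//.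
apply: (@le_trans _ _ (\int[P]_w ((t^-1)%:E * (volume w)%:E))%E).
  apply: integral_le_mono.
  - by move=> w; rewrite lee_fin.
  - by apply/measurable_EFinP; exact: measurable_indic.
  - by apply: measurable_funeM; apply/measurable_EFinP; exact: measurable_volume.
  - move=> w; rewrite -EFinM lee_fin indicE.
    have v0 : 0 <= volume w := volume_factor_ge0 _ _ _.
    case: (boolP (w \in volume_excess t)) => [/set_mem/= tv|_].
      by rewrite mulrC ler_pdivlMr// mul1r ltW.
    by rewrite mulr_ge0// invr_ge0 ltW.
rewrite ge0_integralZl_EFin//; first last.
- by rewrite invr_ge0 ltW.
- by apply/measurable_EFinP; exact: measurable_volume.
- by move=> w _; rewrite lee_fin volume_factor_ge0.
rewrite EFinM; apply: lee_wpmul2l; first by rewrite lee_fin invr_ge0 ltW.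
have := expected_volume_factor indep stdX ha0 beta0 tau0 gap (iota_uniq 0 d).
by rewrite size_iota; apply.
Qed.

End bad_events.

Lemma powR_lt1 (R : realType) (q a : R) : 0 < q -> q < 1 -> 0 < a -> q `^ a < 1.
Proof.
move=> q0 q1 a0; rewrite /powR gt_eqF// expR_lt1 pmulr_rlt0//.
by apply: ln_lt0; rewrite q0.
Qed.

(** * The limit theorem *)

Lemma design_injective (R : realType) (n d : nat) (x : array R (nat * nat)%type) :
  regular (columns n (iota 0 d) x) ->
  forall v : 'cV[R]_d, (\matrix_(i < n, j < d) x (val i, val j)) *m v = 0 -> v = 0.
Proof.
move=> reg v Xv.
pose z (j : nat) := if insub j is Some j' then v j' 0 else 0.
have zE (j : 'I_d) : z j = v j 0 by rewrite /z valK.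
have sum0 : \sum_(j <- iota 0 d) z j *: column n j x = 0.
  rewrite -[d in iota 0 d]subn0 -/(index_iota 0 d) big_mkord -[RHS]Xv.
  apply/colP => i; rewrite summxE mxE; apply: eq_bigr => j _.
  by rewrite zE !mxE mulrC.
apply/colP => j; rewrite mxE -zE; apply: (regular_free reg sum0).
by rewrite mem_iota /= add0n.
Qed.

(** With [b = (1 - sqrt gamma)^2] and [e = sqrt gamma (1 - sqrt gamma)], the
    numbers [b], [b + e], [b + 2 e = 1 - gamma] are in arithmetic progression:
    [b n] is the threshold for the residuals, [e n] the margin that separates it
    from their means, and the last [e] absorbs the fluctuation of [d / n]. *)
Lemma gap_constants (R : realType) (gamma : R) : 0 < gamma < 1 ->
  [/\ 0 < (1 - Num.sqrt gamma) ^+ 2, 0 < Num.sqrt gamma * (1 - Num.sqrt gamma) &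
    (1 - Num.sqrt gamma) ^+ 2 + Num.sqrt gamma * (1 - Num.sqrt gamma) +
      Num.sqrt gamma * (1 - Num.sqrt gamma) = 1 - gamma].
Proof.
move=> /andP[g0 g1]; have s0 : 0 < Num.sqrt gamma by rewrite sqrtr_gt0.
have s1 : Num.sqrt gamma < 1 by rewrite -[ltRHS]sqrtr1 ltr_sqrt.
split; [by rewrite exprn_gt0// subr_gt0|by rewrite mulr_gt0// subr_gt0|].
by rewrite -[in RHS](sqr_sqrtr (ltW g0)); ring.
Qed.

Theorem proposition4 (R : realType) (dsp : measure_display)
    (Omega : measurableType dsp) (P : probability Omega R)
    (g h gamma : R) (d : nat -> nat)
    (X : nat -> nat -> {RV P >-> R}) (Y : nat -> {RV P >-> bool}) :
  0 < g -> 0 < h ->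
  mutually_independent (fun ij : nat * nat => X ij.1 ij.2) ->
  identically_distributed (fun ij : nat * nat => X ij.1 ij.2) ->
  (forall i j, 'E_P[X i j] = 0)%E ->
  (forall i j, 'V_P[X i j] = 1)%E ->
  (forall i j, 'E_P[(fun w => X i j w ^+ 4)%R] < +oo)%E ->
  0 < gamma < 1 ->
  (fun n => (d n)%:R / n%:R : R) @ \oo --> gamma ->
  {ae P, forall w, \forall n \near \oo,
    let Xn : 'M[R]_(n, d n) := \matrix_(i < n, j < d n) X i j w in
    let pi_n := posterior g Xn (fun i : 'I_n => Y i w) in
    [/\ positive_definite (Xn^T *m Xn),
        (exists! b, maximizes pi_n b) &
        forall b, maximizes pi_n b ->
          (rwmh_acceptance h pi_n b <=
           ((h * n%:R * (1 - Num.sqrt gamma) ^+ 2 / (2 * g) + 1)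
              `^ (- ((d n)%:R / 2)))%:E)%E]}.
Proof.
move=> g0 h0 indep ident mean0 var1 fourth gamma01 dn_gamma.
have [b0 e0 be] := gap_constants gamma01.
set b := (1 - Num.sqrt gamma) ^+ 2 in b0 be *.
set e := Num.sqrt gamma * (1 - Num.sqrt gamma) in e0 be.
pose Z (ij : nat * nat) := X ij.1 ij.2.
pose k := fine ('E_P[(fun w => X 0%N 0%N w ^+ 4)%R]).
have E4 i j : ('E_P[(fun w => X i j w ^+ 4)%R] <= k%:E)%E.
  have mp4 : measurable_fun [set: R] (fun x : R => (x ^+ 4)%:E).
    by apply/measurable_EFinP; exact: measurable_funX.
  have p40 (x : R) : (0 <= (x ^+ 4)%:E)%E by rewrite lee_fin exprn_even_ge0.
  have law i' j' : ('E_P[(fun w => X i' j' w ^+ 4)%R] =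
      \int[distribution P (X i' j')]_x (x ^+ 4)%:E)%E.
    by rewrite ge0_integral_distribution// unlock.
  rewrite /k fineK; last first.
    rewrite ge0_fin_numE; first exact: fourth.
    by rewrite law; apply: integral_ge0.
  rewrite !law le_eqVlt; apply/orP; left; apply/eqP.
  by apply: eq_measure_integral => A mA _; exact: (ident (i, j) (0, 0)%N A mA).
have stdZ ij : standardized P k (Z ij) by apply: standardized_of_moments; [exact: mean0|exact: var1|exact: E4].
have k0 : 0 <= k := fourth_moment_ge0 stdZ (0, 0)%N.
have [p [p0 p1 atom0]] := atoms_bounded (stdZ (0, 0)%N).
have atom ij c : (P (Z ij @^-1` [set c]) <= p%:E)%E.
  apply: le_trans (atom0 c); rewrite le_eqVlt; apply/orP; left; apply/eqP.
  exact: (ident ij (0, 0)%N).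
pose c := h * g^-1.
have c0 : 0 < c by rewrite mulr_gt0// invr_gt0.
pose t n := ((Num.sqrt (1 + c * n%:R * b / 2))^-1) ^+ d n.
(* The bad event is taken to be empty for the finitely many other n. *)
pose good n := [/\
  Num.sqrt (1 + c * n%:R * b / 2) * contraction_rate k n c (b * n%:R) (e * n%:R)
      <= 7 / 8,
  gamma / 2 * n%:R <= (d n)%:R, b * n%:R + e * n%:R <= n%:R - (d n)%:R,
  e * n%:R <= n%:R - (d n)%:R & 0 < n%:R :> R].
have good_near : \forall n \near \oo, good n.
  have [/andP[gam0 gam1]] := gamma01.
  near=> n.
  have n0 : 0 < n%:R :> R by rewrite ltr0n; near: n; exact: nbhs_infty_gt.
  have lo : gamma / 2 <= (d n)%:R / n%:R.
    by near: n; apply: (cvgr_ge gamma dn_gamma); lra.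
  have hi : (d n)%:R / n%:R <= gamma + e.
    by near: n; apply: (cvgr_le gamma dn_gamma); lra.
  rewrite ler_pdivlMr// in lo; rewrite ler_pdivrMr// in hi.
  have bn : 0 < b * n%:R by rewrite mulr_gt0.
  have ben : b * n%:R + e * n%:R + e * n%:R = n%:R - gamma * n%:R.
    have -> : b * n%:R + e * n%:R + e * n%:R = (b + e + e) * n%:R by ring.
    by rewrite be mulrBl mul1r.
  split => //; [|lra|lra].
  by near: n; exact: contraction_rate_small.
pose bad n : set Omega :=
  if `[< good n >] then rank_deficiency Z n (d n) `|`
    volume_excess Z n (d n) h g^-1 (t n) else set0.
pose r1 := (7 / 8 : R) `^ (gamma / 2).
pose r2 := p `^ e.
have /andP[gam0 gam1] := gamma01.
have r10 : 0 <= r1 := powR_ge0 _ _.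
have r20 : 0 <= r2 := powR_ge0 _ _.
have r11 : r1 < 1 by apply: powR_lt1; lra.
have r21 : r2 < 1 by exact: powR_lt1.
have q0 : 0 < (1 - p)^-1 by rewrite invr_gt0 subr_gt0.
pose r := Num.max r1 r2.
have badP n : (P (bad n) <= (((1 - p)^-1 + 1) * r ^+ n)%:E)%E.
  rewrite /bad; case: asboolP => [[rate dlo gap gap' n0]|_]; last first.
    rewrite measure0 lee_fin mulr_ge0 ?exprn_ge0 ?le_max ?r10//.
    by rewrite addr_ge0// ltW.
  have dn : (d n <= n)%N.
    rewrite -(ler_nat R) -subr_ge0; apply: le_trans gap'.
    by rewrite mulr_ge0// ltW.
  apply: (le_trans (measureU2 P _ _)).
  - exact: measurable_rank_deficiency.
  - exact: measurable_volume_excess.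
  rewrite mulrDl mul1r EFinD; apply: leeD.
    apply: le_trans (rank_deficiency_bound indep (ltW p0) p1 atom dn) _.
    rewrite lee_fin ler_wpM2l ?(ltW q0)//.
    apply: (@le_trans _ _ (r2 ^+ n)).
      by apply: expn_le_geometric => //; rewrite ?natrB// ltW.
    by apply: lerXn2r; rewrite ?nnegrE ?le_max ?lexx ?r20 ?orbT.
  set s := 1 + c * n%:R * b / 2.
  have s0 : 0 < s by rewrite /s; have := mulr_gt0 (mulr_gt0 c0 n0) b0; lra.
  have t0 : 0 < t n by rewrite exprn_gt0// invr_gt0 sqrtr_gt0.
  apply: le_trans (volume_excess_bound indep stdZ t0 (ltW c0) _ _ gap) _.
  - by rewrite mulr_ge0// ltW.
  - by rewrite mulr_gt0.
  rewrite lee_fin /t -exprVn invrK -exprMn.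
  apply: (@le_trans _ _ ((7 / 8) ^+ d n)).
    apply: lerXn2r => //; rewrite nnegrE; last lra.
    rewrite mulr_ge0 ?sqrtr_ge0//; apply: (contraction_rate_ge0 stdZ).
    by rewrite mulr_gt0.
  apply: (@le_trans _ _ (r1 ^+ n)).
    by apply: expn_le_geometric => //; lra.
  by apply: lerXn2r; rewrite ?nnegrE ?le_max ?lexx ?r10.
have mbad n : measurable (bad n).
  rewrite /bad; case: ifP => // _; apply: measurableU.
    exact: measurable_rank_deficiency.
  exact: measurable_volume_excess.
have := ae_eventually_notin mbad _ _ _ badP.
rewrite le_max r10 gt_max r11 r21 addr_ge0 ?(ltW q0)// => /(_ isT isT isT).
apply: filterS => w wbad.
near=> n.
have good_n : good n by near: n.
have : ~ bad n w by near: n.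
rewrite /bad; have -> : `[< good n >] = true by apply/asboolP.
move=> /not_orP[wrank wvol].
have [_ _ _ _ n0] := good_n.
have reg := regular_off_rank_deficiency wrank.
have inj := design_injective reg.
have XnE : \matrix_(i < n, j < d n) X i j w =
    \matrix_(i < n, j < d n) (sample Z w) (val i, val j).
  by apply/matrixP => i j; rewrite !mxE.
rewrite XnE.
split.
- exact: gram_positive_definite.
- exact: exists_unique_mode.
move=> beta bmax.
have size_s : size (columns n (iota 0 (d n)) (sample Z w)) = d n.
  by rewrite size_map size_iota.
have col_s (i : 'I_(d n)) : col i (\matrix_(i < n, j < d n) (sample Z w) (val i, val j)) =
    nth 0 (columns n (iota 0 (d n)) (sample Z w)) i.
  rewrite (nth_map 0%N) ?size_iota// nth_iota// add0n.
  by apply/colP => l; rewrite !mxE.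
apply: le_trans (acceptance_at_mode g0 h0 inj size_s col_s bmax) _.
rewrite lee_fin.
have -> : h * n%:R * b / (2 * g) + 1 = 1 + c * n%:R * b / 2.
  by rewrite /c invfM; ring.
rewrite powR_sqrt_expn; last first.
  by have := mulr_gt0 (mulr_gt0 c0 n0) b0; lra.
by rewrite leNgt; apply/negP.
Unshelve. all: by end_near. Qed.
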